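(* Let $n\ge 3$, $m=\frac{n-2}{n+2}$, and let $g_{ij}=u^{\frac{4}{n+2}}\,dx^2$ be a conformally flat, rotationally symmetric Yamabe gradient soliton on $\mathbb{R}^n$ with constant $\rho$ and with positive sectional curvature. Then there is a constant $\beta\ge 0$ such that $u$ is a smooth solution of the elliptic equation $$\frac{n-1}{m}\,\Delta u^m+\beta\,x\cdot\nabla u+\gamma\,u=0\quad\text{on }\mathbb{R}^n,\qquad \gamma=\frac{2\beta+\rho}{1-m}.$$ In the case of the expanders ($\rho<0$), $\beta>0$. In addition, any smooth positive solution $u$ of this elliptic equation, with $\beta\ge 0$ ($\beta>0$ if $\rho<0$) and $\gamma=\frac{2\beta+\rho}{1-m}$, defines a gradient Yamabe soliton $g=u^{\frac{4}{n+2}}\,dx^2$.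
   Context: A Riemannian metric $g$ with scalar curvature $R$ is a Yamabe gradient soliton with constant $\rho\in\mathbb{R}$ if there exists a smooth function $f$ such that $(R-\rho)\,g_{ij}=\nabla_i\nabla_j f$; it is a shrinker, expander or steady soliton if $\rho>0$, $\rho<0$, $\rho=0$ respectively. Here $dx^2$ is the standard Euclidean metric on $\mathbb{R}^n$, $u>0$ is a function on $\mathbb{R}^n$ (so that $u^{4/(n+2)}$ is the conformal factor), $\Delta$ and $\nabla$ in the elliptic equation are Euclidean, and rotationally symmetric means that $u$ depends only on $r=|x|$.
   Formalization: In the last claim (''any smooth positive solution u ... defines a gradient Yamabe soliton'') u is additionally assumed rotationally symmetric; for general u it is false, e.g. for non-constant solutions u(x_1) with rho = -2 beta < 0. *)

(* Defs.v *)
From HB Require Import structures.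
From mathcomp Require Import all_boot all_order all_algebra.
From mathcomp Require Import all_classical all_reals all_analysis.

Set Implicit Arguments.
Unset Strict Implicit.
Unset Printing Implicit Defensive.
Import Order.TTheory GRing.Theory Num.Theory.
Import numFieldNormedType.Exports.
Local Open Scope ring_scope.

(* The canonical norm `|x| of 'rV[R]_n is the sup norm, hence this one. *)
Definition enorm (R : realType) (n : nat) (x : 'rV[R]_n) : R :=
  Num.sqrt (\sum_(i < n) x 0 i ^+ 2).

Definition rotationally_symmetric (R : realType) (n : nat)
    (u : 'rV[R]_n -> R) : Prop :=
  exists phi : R -> R, forall x, u x = phi (enorm x).

Definition partial (R : realType) (n : nat) (i : 'I_n) (f : 'rV[R]_n -> R)
    (x : 'rV[R]_n) : R :=
  'D_(delta_mx 0 i) f x.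

Fixpoint is_Ck (R : realType) (n : nat) (k : nat) (f : 'rV[R]_n -> R) : Prop :=
  if k is k'.+1 then
    (forall x, differentiable f x) /\ (forall i, is_Ck k' (partial i f))
  else continuous f.

Definition smooth (R : realType) (n : nat) (f : 'rV[R]_n -> R) : Prop :=
  forall k, is_Ck k f.

Definition laplacian (R : realType) (n : nat) (f : 'rV[R]_n -> R)
    (x : 'rV[R]_n) : R :=
  \sum_(i < n) partial i (partial i f) x.

(* A (0,2)-tensor field on R^n is given by its matrix (g_ij) in the standard
   global coordinates. *)
Definition inner (R : realType) (n : nat) (g : 'rV[R]_n -> 'M[R]_n)
    (x v w : 'rV[R]_n) : R :=
  (v *m g x *m w^T) 0 0.

Definition riemannian_metric (R : realType) (n : nat)
    (g : 'rV[R]_n -> 'M[R]_n) : Prop :=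
  [/\ forall i j, smooth (fun x => g x i j),
      forall x, (g x)^T = g x
    & forall x (v : 'rV[R]_n), v != 0 -> 0 < inner g x v v].

(* christoffel g k i j is Gamma^k_ij. *)
Definition christoffel (R : realType) (n : nat) (g : 'rV[R]_n -> 'M[R]_n)
    (k i j : 'I_n) (x : 'rV[R]_n) : R :=
  2^-1 * \sum_(l < n) invmx (g x) k l *
    (partial i (fun y => g y j l) x + partial j (fun y => g y i l) x
     - partial l (fun y => g y i j) x).

(* riemann g l k i j is the component R^l_kij of the (1,3) curvature tensor:
   (nabla_i nabla_j - nabla_j nabla_i) d_k = sum_l R^l_kij d_l. *)
Definition riemann (R : realType) (n : nat) (g : 'rV[R]_n -> 'M[R]_n)
    (l k i j : 'I_n) (x : 'rV[R]_n) : R :=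
  partial i (christoffel g l j k) x - partial j (christoffel g l i k) x
  + \sum_(p < n) (christoffel g l i p x * christoffel g p j k x
                  - christoffel g l j p x * christoffel g p i k x).

Definition ricci (R : realType) (n : nat) (g : 'rV[R]_n -> 'M[R]_n)
    (j k : 'I_n) (x : 'rV[R]_n) : R :=
  \sum_(i < n) riemann g i k i j x.

Definition scalar_curvature (R : realType) (n : nat)
    (g : 'rV[R]_n -> 'M[R]_n) (x : 'rV[R]_n) : R :=
  \sum_(j < n) \sum_(k < n) invmx (g x) j k * ricci g j k x.

Definition curvature_op (R : realType) (n : nat) (g : 'rV[R]_n -> 'M[R]_n)
    (x v w z : 'rV[R]_n) : 'rV[R]_n :=
  \row_l \sum_(i < n) \sum_(j < n) \sum_(k < n)
    riemann g l k i j x * v 0 i * w 0 j * z 0 k.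

Definition sectional_curvature (R : realType) (n : nat)
    (g : 'rV[R]_n -> 'M[R]_n) (x v w : 'rV[R]_n) : R :=
  inner g x (curvature_op g x v w w) v /
    (inner g x v v * inner g x w w - inner g x v w ^+ 2).

Definition positive_sectional_curvature (R : realType) (n : nat)
    (g : 'rV[R]_n -> 'M[R]_n) : Prop :=
  forall x v w : 'rV[R]_n, row_free (col_mx v w) ->
    0 < sectional_curvature g x v w.

Definition hessian (R : realType) (n : nat) (g : 'rV[R]_n -> 'M[R]_n)
    (f : 'rV[R]_n -> R) (i j : 'I_n) (x : 'rV[R]_n) : R :=
  partial i (partial j f) x - \sum_(k < n) christoffel g k i j x * partial k f x.

Definition yamabe_gradient_soliton (R : realType) (n : nat)
    (g : 'rV[R]_n -> 'M[R]_n) (rho : R) : Prop :=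
  riemannian_metric g /\
  exists2 f : 'rV[R]_n -> R, smooth f &
    forall x i j, (scalar_curvature g x - rho) * g x i j = hessian g f i j x.

(* u^(4/(n+2)) dx^2 *)
Definition conformal_metric (R : realType) (n : nat) (u : 'rV[R]_n -> R)
    (x : 'rV[R]_n) : 'M[R]_n :=
  (u x `^ (4 / (n%:R + 2)))%:M.

Definition elliptic_equation (R : realType) (n : nat) (m beta gamma : R)
    (u : 'rV[R]_n -> R) : Prop :=
  forall x : 'rV[R]_n,
    (n%:R - 1) / m * laplacian (fun y => u y `^ m) x
    + beta * (\sum_(i < n) x 0 i * partial i u x) + gamma * u x = 0.

(* Main.v *)
Require Import Defs.
From HB Require Import structures.
From mathcomp Require Import all_boot all_order all_algebra.
From mathcomp Require Import all_classical all_reals all_analysis.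
From mathcomp Require Import ring lra.
Import Order.TTheory GRing.Theory Num.Theory.
Import numFieldNormedType.Exports.
Local Open Scope ring_scope.

(** Write the metric as [g = e ^ (2 phi) dx ^ 2] with [phi = 2 / (n + 2) * ln u], so that
    [u] and its powers are exponentials of multiples of [phi], and let
    [k = x . grad phi]. The formula for the scalar curvature [R] of a conformally
    flat metric turns the elliptic equation into the first order identity
    [R - rho = 2 beta (1 + k)] ([elliptic_equation_exp]). The theorem is thus about
    this identity.

    Elliptic equation to soliton. Since [phi] is radial, the vector field
    [2 beta e ^ (2 phi) x] is the Euclidean gradient of some smooth [f]
    ([radial_potential]), and its Hessian for [g] is [2 beta (1 + k) g], that is
    [(R - rho) g] ([radial_soliton]).

    Soliton to elliptic equation. The off-diagonal Hessian equations restrict [f]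
    so much that, along one coordinate axis and after symmetrization under
    [t |-> - t], the equations become linear and are solved explicitly:
    [R - rho = c (1 + k)] on the axis for a constant [c] ([axis_soliton]), hence
    everywhere because [R] and [k] are radial ([soliton_profile]). So
    [beta = c / 2] works.

    Sign of [beta]. At the origin [k = 0], so [rho + c] is the scalar curvature
    there, which is positive; hence [c > 0] as soon as [rho <= 0]. If [rho > 0] and
    [c < 0], then [R] increases along rays, and two monotone quantities show that
    the metric would have to close up before reaching infinity
    ([profile_contradiction]): the geodesic spheres cannot shrink to a point, yet
    the radial curvature is bounded below. *)

(** * Partial derivatives of scalar fields *)

Section PartialCalculus.
Context {R : realType} {n : nat}.
Implicit Types (f g : 'rV[R]_n -> R) (x v : 'rV[R]_n).

Lemma derive_partialE f x v : differentiable f x ->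
  'D_v f x = \sum_i v 0 i * partial i f x.
Proof.
move=> df; rewrite deriveE// [in LHS](row_sum_delta v) linear_sum.
by apply: eq_bigr => i _; rewrite linearZ /= /partial deriveE.
Qed.

Lemma partial_cst i (c : R) x : partial i (fun=> c : R) x = 0.
Proof. exact: derive_cst. Qed.

Lemma partialD i f g x : differentiable f x -> differentiable g x ->
  partial i (fun y => f y + g y) x = partial i f x + partial i g x.
Proof. by move=> df dg; apply: deriveD; exact: diff_derivable. Qed.

Lemma partialM i f g x : differentiable f x -> differentiable g x ->
  partial i (fun y => f y * g y) x = partial i f x * g x + f x * partial i g x.
Proof.
move=> df dg; rewrite addrC [_ * g x]mulrC.
by apply: deriveM; exact: diff_derivable.
Qed.

Lemma partialZ i (c : R) f x : differentiable f x ->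
  partial i (fun y => c * f y) x = c * partial i f x.
Proof. by move=> df; apply: deriveZ; exact: diff_derivable. Qed.

Lemma partial_coord i j x :
  partial i (fun y : 'rV[R]_n => y 0 j) x = (i == j)%:R.
Proof.
rewrite /partial /derive.
rewrite (_ : (fun h => _) = (fun h : R => h^-1 * h * (i == j)%:R)); last first.
  by apply/funext => h /=; rewrite !mxE eqxx eq_sym addrK /GRing.scale /= mulrA.
apply: cvg_lim => //.
apply: (@cvg_trans _ ((i == j)%:R @[h --> (0:R)^'])%classic); last exact: cvg_cst.
apply: near_eq_cvg; near=> h.
by rewrite mulVf ?mul1r//; near: h; exact: nbhs_dnbhs_neq.
Unshelve. all: by end_near. Qed.

Lemma partial_comp i (h : R -> R) (h' : R) f x :
  differentiable f x -> is_derive (f x) 1 h h' ->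
  partial i (fun y => h (f y)) x = h' * partial i f x.
Proof.
move=> df [dh <-].
have dh1 : differentiable h (f x) by exact/derivable1_diffP.
rewrite /partial !deriveE //; last exact: differentiable_comp.
rewrite diff_comp //= (deriv1E dh) derive1E.
by rewrite [_ *: _]mulrC scale1r.
Qed.

Lemma differentiable_scalar_comp (h : R -> R) (h' : R) f x :
  differentiable f x -> is_derive (f x) 1 h h' ->
  differentiable (fun y => h (f y)) x.
Proof.
move=> df [dh _]; apply: differentiable_comp => //.
exact/derivable1_diffP.
Qed.

Lemma partial_expR i f x : differentiable f x ->
  partial i (fun y => expR (f y)) x = expR (f x) * partial i f x.
Proof. by move=> df; apply: partial_comp. Qed.

Lemma is_derive_affine_line f x v (t : R) : differentiable f (x + t *: v) ->
  is_derive t 1 (fun s : R => f (x + s *: v)) ('D_v f (x + t *: v)).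
Proof.
move=> df; have E : (fun h : R => h^-1 *: (((fun s : R => f (x + s *: v)) \o shift t)
   (h *: (1:R)) - f (x + t *: v))) =
   (fun h : R => h^-1 *: ((f \o shift (x + t *: v)) (h *: v) - f (x + t *: v))).
  apply/funext => h /=; rewrite scalerDl /GRing.scale /= mulr1.
  by rewrite addrCA.
split; last by rewrite /derive E.
rewrite /derivable E.
exact: (diff_derivable df).
Qed.

Lemma is_derive_line f v (t : R) : differentiable f (t *: v) ->
  is_derive t 1 (fun s : R => f (s *: v)) ('D_v f (t *: v)).
Proof.
rewrite -[t *: v]add0r => /is_derive_affine_line.
by rewrite (_ : (fun s => f (s *: v)) = fun s => f (0 + s *: v))//;
  apply/funext => s; rewrite add0r.
Qed.

End PartialCalculus.

(** * Smooth functions and the symmetry of second derivatives *)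

Section Smooth.
Context {R : realType} {n : nat}.
Implicit Types (f g : 'rV[R]_n -> R) (x v : 'rV[R]_n).

Lemma is_CkW k f : is_Ck k.+1 f -> is_Ck k f.
Proof.
elim: k f => [|k IH] f; case=> df pf.
  by move=> x; exact/differentiable_continuous.
by split=> // i; apply: IH; apply: pf.
Qed.

Lemma is_Ck_cst k (c : R) : is_Ck k (fun _ : 'rV[R]_n => c).
Proof.
elim: k c => [|k IH] c; first exact: cst_continuous.
split=> [x|i]; first exact: differentiable_cst.
rewrite (_ : partial i _ = fun=> 0); first exact: IH.
by apply/funext => x; exact: partial_cst.
Qed.

Lemma is_Ck_coord k (j : 'I_n) : is_Ck k (fun x : 'rV[R]_n => x 0 j).
Proof.
case: k => [|k].
  by move=> x; apply: differentiable_continuous; exact: differentiable_coord.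
split=> [x|i]; first exact: differentiable_coord.
rewrite (_ : partial i _ = fun=> (i == j)%:R); first exact: is_Ck_cst.
by apply/funext => x; exact: partial_coord.
Qed.

Lemma is_CkD k f g : is_Ck k f -> is_Ck k g -> is_Ck k (fun x => f x + g x).
Proof.
elim: k f g => [|k IH] f g.
  by move=> cf cg x; exact: (continuousD (cf x) (cg x)).
move=> [df pf] [dg pg]; split=> [x|i]; first exact: differentiableD.
rewrite (_ : partial i _ = fun x => partial i f x + partial i g x).
  by apply: IH; [exact: pf | exact: pg].
by apply/funext => x; exact: partialD.
Qed.

Lemma is_CkM k f g : is_Ck k f -> is_Ck k g -> is_Ck k (fun x => f x * g x).
Proof.
elim: k f g => [|k IH] f g.
  by move=> cf cg x; exact: (continuousM (cf x) (cg x)).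
move=> fk gk; have [df pf] := fk; have [dg pg] := gk.
split=> [x|i]; first exact: differentiableM.
rewrite (_ : partial i _ = fun x => partial i f x * g x + f x * partial i g x).
  by apply: is_CkD; apply: IH => //; (exact: is_CkW || exact: pf || exact: pg).
by apply/funext => x; exact: partialM.
Qed.

Lemma is_Ck_expR k f : is_Ck k f -> is_Ck k (fun x => expR (f x)).
Proof.
elim: k f => [|k IH] f.
  by move=> cf x; apply: continuous_comp; [exact: cf | exact: continuous_expR].
move=> fk; have [df pf] := fk; split=> [x|i].
  exact: differentiable_scalar_comp.
rewrite (_ : partial i _ = fun x => expR (f x) * partial i f x).
  by apply: is_CkM; [apply: IH; exact: is_CkW | exact: pf].
by apply/funext => x; exact: partial_expR.
Qed.

(** The derivative of [ln \o f] is [expR (- ln f)] times that of [f], so one more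
    order of smoothness follows from the previous one and the rule for [expR]. *)
Lemma is_Ck_ln k f : (forall x, 0 < f x) -> is_Ck k f ->
  is_Ck k (fun x => ln (f x)).
Proof.
move=> f0; elim: k => [|k IH].
  by move=> cf x; apply: continuous_comp; [exact: cf | exact: continuous_ln].
move=> fk; have [df pf] := fk; split=> [x|i].
  by apply: differentiable_scalar_comp => //; exact: is_derive1_ln.
rewrite (_ : partial i _ = fun x => expR (-1 * ln (f x)) * partial i f x).
  apply: is_CkM; last exact: pf.
  apply: is_Ck_expR; apply: is_CkM; first exact: is_Ck_cst.
  by apply: IH; exact: is_CkW.
apply/funext => x; rewrite mulN1r expRN lnK ?posrE//.
by apply: partial_comp => //; exact: is_derive1_ln.
Qed.

Lemma smooth_cst (c : R) : smooth (fun _ : 'rV[R]_n => c).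
Proof. by move=> k; exact: is_Ck_cst. Qed.

Lemma smooth_coord (j : 'I_n) : smooth (fun x : 'rV[R]_n => x 0 j).
Proof. by move=> k; exact: is_Ck_coord. Qed.

Lemma smoothD f g : smooth f -> smooth g -> smooth (fun x => f x + g x).
Proof. by move=> sf sg k; apply: is_CkD. Qed.

Lemma smoothM f g : smooth f -> smooth g -> smooth (fun x => f x * g x).
Proof. by move=> sf sg k; apply: is_CkM. Qed.

Lemma smoothZ (c : R) f : smooth f -> smooth (fun x => c * f x).
Proof. by move=> sf; apply: smoothM => //; exact: smooth_cst. Qed.

Lemma smooth_sum (I : Type) (r : seq I) (F : I -> 'rV[R]_n -> R) :
  (forall i, smooth (F i)) -> smooth (fun x => \sum_(i <- r) F i x).
Proof.
move=> sF; elim: r => [|a r IH].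
  by under eq_fun do rewrite big_nil; exact: smooth_cst.
by under eq_fun do rewrite big_cons; exact: smoothD.
Qed.

Lemma smooth_expR f : smooth f -> smooth (fun x => expR (f x)).
Proof. by move=> sf k; apply: is_Ck_expR. Qed.

Lemma smooth_ln f : (forall x, 0 < f x) -> smooth f ->
  smooth (fun x => ln (f x)).
Proof. by move=> f0 sf k; apply: is_Ck_ln. Qed.

Lemma smooth_partial i [f] : smooth f -> smooth (partial i f).
Proof. by move=> sf k; have [_ /(_ i)] := sf k.+1. Qed.

Lemma smooth_differentiable [f] x : smooth f -> differentiable f x.
Proof. by move=> sf; have [/(_ x)] := sf 1%N. Qed.

Lemma smooth_continuous f : smooth f -> continuous f.
Proof. by move=> sf; exact: sf 0%N. Qed.

(** The mean value theorem is applied twice: along [e_i] to the increment of [f]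
    in the direction [e_j], then along [e_j] to [partial i f]. The left-hand side
    is symmetric in [i] and [j], which is what makes second partials commute. *)
Lemma second_difference f x i j (h : R) : smooth f -> 0 < h ->
  exists p q : R, [/\ 0 <= p <= h, 0 <= q <= h &
   f (x + h *: delta_mx 0 i + h *: delta_mx 0 j) - f (x + h *: delta_mx 0 i)
   - f (x + h *: delta_mx 0 j) + f x
   = h * h * partial j (partial i f) (x + p *: delta_mx 0 i + q *: delta_mx 0 j)].
Proof.
move=> sf h0; set ei := delta_mx 0 i; set ej := delta_mx 0 j.
pose F (s : R) := f (x + h *: ej + s *: ei) - f (x + s *: ei).
pose dF (s : R) := partial i f (x + h *: ej + s *: ei) - partial i f (x + s *: ei).
have dFP (s : R) : is_derive s 1 F (dF s).
  have d1 := is_derive_affine_line f (x + h *: ej) ei s (smooth_differentiable _ sf).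
  have d2 := is_derive_affine_line f x ei s (smooth_differentiable _ sf).
  exact: is_deriveB.
have [p pI Fp] : exists2 c : R, c \in `]0, h[ & F h - F 0 = dF c * (h - 0).
  apply: MVT => //; apply: continuous_subspaceT => s.
  by apply/differentiable_continuous/derivable1_diffP; case: (dFP s).
pose G (s : R) := partial i f (x + p *: ei + s *: ej).
pose dG (s : R) := partial j (partial i f) (x + p *: ei + s *: ej).
have dGP (s : R) : is_derive s 1 G (dG s).
  apply: is_derive_affine_line; apply: smooth_differentiable.
  exact: smooth_partial.
have [q qI Gq] : exists2 c : R, c \in `]0, h[ & G h - G 0 = dG c * (h - 0).
  apply: MVT => //; apply: continuous_subspaceT => s.
  by apply/differentiable_continuous/derivable1_diffP; case: (dGP s).
exists p, q; split.
- by move: pI; rewrite in_itv /= => /andP[/ltW-> /ltW->].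
- by move: qI; rewrite in_itv /= => /andP[/ltW-> /ltW->].
have -> : partial j (partial i f) (x + p *: ei + q *: ej) = dG q by [].
transitivity (F h - F 0).
  rewrite /F !scale0r !addr0 (addrAC x (h *: ej)); ring.
rewrite Fp (_ : dF p = G h - G 0); last first.
  by rewrite /G /dF scale0r addr0 (addrAC x (h *: ej)).
by rewrite Gq subr0; ring.
Qed.

(** Schwarz: the mixed second difference divided by [h ^ 2] is a value of either
    mixed partial at a point that tends to [x] with [h], and both mixed partials
    are continuous. *)
Lemma partial_comm [f] i j x : smooth f ->
  partial i (partial j f) x = partial j (partial i f) x.
Proof.
move=> sf; apply/eqP; rewrite -subr_eq0 -normr_eq0; apply/eqP.
apply/eqP; rewrite eq_le normr_ge0 andbT; apply/ler_addgt0Pr => e e0.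
rewrite add0r.
have cont a b : \forall y \near x,
    `|partial a (partial b f) x - partial a (partial b f) y| < e / 2.
  have /(_ x) : continuous (partial a (partial b f)).
    by apply: smooth_continuous; do 2 apply: smooth_partial.
  by move/cvgrPdist_lt; apply; rewrite divr_gt0.
have /nbhs_ballP[d /= d0 near_x] : \forall y \near x,
    `|partial i (partial j f) x - partial i (partial j f) y| < e / 2 /\
    `|partial j (partial i f) x - partial j (partial i f) y| < e / 2.
  by apply: filterI; [exact: (cont i j) | exact: (cont j i)].
pose h := d / 2 / 2.
have h0 : 0 < h by rewrite !divr_gt0.
have small a b p q : 0 <= p <= h -> 0 <= q <= h ->
    ball x d (x + p *: delta_mx 0 a + q *: delta_mx 0 b).
  move=> /andP[p0 ph] /andP[q0 qh]; rewrite -ball_normE /= -addrA opprD addNKr.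
  rewrite normrN (le_lt_trans (ler_normD _ _))//.
  (* the norm of row vectors is the sup norm *)
  have nd (c : 'I_n) : `|delta_mx 0 c : 'rV[R]_n| <= 1.
    rewrite [`|_|]mx_normrE bigmax_le // => k _; rewrite mxE.
    by case: (_ && _); rewrite ?normr1 ?normr0.
  rewrite !normrZ !ger0_norm//.
  have := ler_wpM2l p0 (nd a); have := ler_wpM2l q0 (nd b).
  rewrite !mulr1 => A B; rewrite (le_lt_trans (lerD B A))//.
  rewrite (le_lt_trans (lerD ph qh))// /h; lra.
have [p [q [pI qI E1]]] := second_difference f x i j h sf h0.
have [p' [q' [pI' qI' E2]]] := second_difference f x j i h sf h0.
have := near_x _ (small i j p q pI qI); have := near_x _ (small j i p' q' pI' qI').
move=> [+ _] [_].
have -> : partial j (partial i f) (x + p *: delta_mx 0 i + q *: delta_mx 0 j) =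
  partial i (partial j f) (x + p' *: delta_mx 0 j + q' *: delta_mx 0 i).
  apply: (@mulfI _ (h * h)); first by rewrite mulf_neq0// gt_eqF.
  apply: (etrans (esym E1)); apply: (etrans _ E2).
  by rewrite (addrAC x (h *: delta_mx 0 j)) (addrAC _ (- f (x + h *: delta_mx 0 i))).
set a := partial i _ x; set b := partial j _ x; set c := partial i _ _.
move: a b c => a b c bc ac; rewrite (_ : a - b = (a - c) + (c - b)); last by ring.
rewrite (le_trans (ler_normD _ _))// [e]splitr lerD//; first exact: ltW.
by rewrite distrC ltW.
Unshelve. all: by end_near. Qed.

End Smooth.

(** * Curvature and Hessian of a conformally flat metric *)

(** Turning derivatives, exponentials and Kronecker deltas into variables spares
    [ring] from comparing them through the limits that define them. *)
Ltac name_atoms R :=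
  repeat match goal with
  | |- context [@partial ?S ?n ?i ?f ?x] =>
      let a := fresh "a" in set a : R := @partial S n i f x; clearbody a
  | |- context [@GRing.natmul ?V ?o (nat_of_bool ?b)] =>
      let a := fresh "a" in set a : R := @GRing.natmul V o (nat_of_bool b);
      clearbody a
  | |- context [@expR ?S ?t] =>
      let a := fresh "a" in set a : R := @expR S t; clearbody a
  end.

Section ConformallyFlat.
Context {R : realType} {n : nat}.
Implicit Types (f : 'rV[R]_n -> R) (x : 'rV[R]_n) (i j k l : 'I_n).

Lemma sum_deltal (F : 'I_n -> R) k : \sum_l (k == l)%:R * F l = F k.
Proof.
rewrite (bigD1 k)//= eqxx mul1r big1 ?addr0// => l lk.
by rewrite eq_sym (negbTE lk) mul0r.
Qed.

Lemma sum_deltar (F : 'I_n -> R) k : \sum_l (l == k)%:R * F l = F k.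
Proof. by rewrite -[RHS]sum_deltal; apply: eq_bigr => l _; rewrite eq_sym. Qed.

Lemma sum_delta_mul (D B : 'I_n -> R) (a b c : R) i l :
  \sum_p ((p == l)%:R * a + c * D p - (i == p)%:R * b) * B p =
  a * B l + c * (\sum_p D p * B p) - b * B i.
Proof.
rewrite -(sum_deltar B l) -(sum_deltal B i) !mulr_sumr -sumrN -!big_split /=.
by apply: eq_bigr => p _; name_atoms R; ring.
Qed.

Lemma sum_off_diagonal (A : 'I_n -> R) (c : R) :
  \sum_j \sum_i (1 - (i == j)%:R) * (A i + A j - c) =
  (n%:R - 1) * (2 * (\sum_i A i) - n%:R * c).
Proof.
have cst (a : R) : \sum_(i < n) a = n%:R * a.
  by rewrite sumr_const card_ord mulr_natl.
transitivity (\sum_j ((\sum_i A i) + n%:R * A j - n%:R * c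
                        - (A j + A j - c))).
  apply: eq_bigr => j _.
  rewrite -(sum_deltar (fun i => A i + A j - c) j) -!cst -sumrN -!big_split /=.
  by rewrite -sumrN -big_split /=; apply: eq_bigr => i _; name_atoms R; ring.
rewrite !(big_split, sumrN) /= !cst -mulr_sumr; move: (\sum_i A i) => S; ring.
Qed.

Definition exp_metric (phi : 'rV[R]_n -> R) (x : 'rV[R]_n) : 'M[R]_n :=
  (expR (2 * phi x))%:M.

Definition grad_dot f h x : R := \sum_i partial i f x * partial i h x.

Context {phi : 'rV[R]_n -> R}.
Hypothesis sphi : smooth phi.
Let dphi x : differentiable phi x := smooth_differentiable x sphi.
Let dpphi i x : differentiable (partial i phi) x :=
  smooth_differentiable x (smooth_partial i sphi).
Local Notation g := (exp_metric phi).
Local Notation d i := (partial i phi).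
Local Notation dd i j := (partial i (partial j phi)).

Lemma exp_metricE x i j : g x i j = (i == j)%:R * expR (2 * phi x).
Proof. by rewrite /exp_metric mxE [RHS]mulr_natl. Qed.

Lemma invmx_exp_metric x i j :
  invmx (g x) i j = (i == j)%:R * (expR (2 * phi x))^-1.
Proof. by rewrite /exp_metric invmx_scalar mxE [RHS]mulr_natl. Qed.

Lemma smooth_exp2 : smooth (fun x => expR (2 * phi x)).
Proof. by apply: smooth_expR; apply: smoothZ. Qed.

Lemma partial_exp_metric i j l x :
  partial i (fun y => g y j l) x = (j == l)%:R * (2 * d i x * expR (2 * phi x)).
Proof.
rewrite (_ : (fun y => _) = fun y => (j == l)%:R * expR (2 * phi y)); last first.
  by apply/funext => y; rewrite exp_metricE.
rewrite partialZ; last exact: (smooth_differentiable x smooth_exp2).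
rewrite partial_expR; last exact/(smooth_differentiable x)/smoothZ.
by rewrite partialZ// mulrC [in RHS]mulrC (mulrC (expR _)).
Qed.

Lemma christoffel_exp_metric k i j x : christoffel g k i j x =
  (j == k)%:R * d i x + (i == k)%:R * d j x - (i == j)%:R * d k x.
Proof.
rewrite /christoffel.
under eq_bigr => l _ do rewrite invmx_exp_metric -mulrA.
rewrite sum_deltal !partial_exp_metric.
have := expR_gt0 (2 * phi x); move: (expR _) => e e0.
by name_atoms R; field; rewrite gt_eqF.
Qed.

Lemma christoffel_mul_sum l i j k x :
  \sum_p christoffel g l i p x * christoffel g p j k x =
  (k == l)%:R * d i x * d j x + (j == l)%:R * d i x * d k x
  + (i == l)%:R * (2 * d j x * d k x - (j == k)%:R * grad_dot phi phi x)
  - (i == k)%:R * d l x * d j x - (i == j)%:R * d l x * d k x.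
Proof.
pose D p := d p x.
pose B p := (k == p)%:R * D j + (j == p)%:R * D k - (j == k)%:R * D p.
transitivity (\sum_p ((p == l)%:R * D i + (i == l)%:R * D p - (i == p)%:R * D l)
                * B p).
  by apply: eq_bigr => p _; rewrite !christoffel_exp_metric.
rewrite sum_delta_mul.
have -> : \sum_p D p * B p = 2 * D j * D k - (j == k)%:R * grad_dot phi phi x.
  rewrite (eq_bigr (fun p => ((p == j)%:R * D k + (- (j == k)%:R) * D p
    - (k == p)%:R * - D j) * D p)); last first.
    by move=> p _; rewrite /B (eq_sym p j); move: (D) => E; name_atoms R; ring.
  rewrite sum_delta_mul -/(grad_dot phi phi x); move: (D) (grad_dot _ _ _) => E N.
  by name_atoms R; ring.
rewrite /B -![d _ x]/(D _) (eq_sym k i) (eq_sym j i).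
by move: (D) (grad_dot _ _ _) => E N; name_atoms R; ring.
Qed.

Lemma riemann_exp_metric l k i j x : riemann g l k i j x =
  (k == l)%:R * (dd i j x - dd j i x) + (j == l)%:R * dd i k x
  - (j == k)%:R * dd i l x - (i == l)%:R * dd j k x + (i == k)%:R * dd j l x
  + (i == l)%:R * (d j x * d k x - (j == k)%:R * grad_dot phi phi x)
  - (j == l)%:R * (d i x * d k x - (i == k)%:R * grad_dot phi phi x)
  - (i == k)%:R * d l x * d j x + (j == k)%:R * d l x * d i x.
Proof.
pose dG a l' i' j' := (j' == l')%:R * dd a i' x + (i' == l')%:R * dd a j' x
    + (- (i' == j')%:R) * dd a l' x.
have dGE a l' i' j' : partial a (christoffel g l' i' j') x = dG a l' i' j'.
  have -> : christoffel g l' i' j' = fun y => (j' == l')%:R * d i' y +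
    (i' == l')%:R * d j' y + (- (i' == j')%:R) * d l' y.
    by apply/funext => y; rewrite christoffel_exp_metric mulNr.
  have sZ c b : differentiable (fun y => c * d b y) x.
    by apply: smooth_differentiable; apply: smoothZ; exact: smooth_partial.
  have pZ c b : partial a (fun y => c * d b y) x = c * dd a b x.
    exact: partialZ.
  apply: (etrans (partialD a _ _ x (differentiableD (sZ (j' == l')%:R i')
    (sZ (i' == l')%:R j')) (sZ (- (i' == j')%:R) l'))).
  congr (_ + _); last exact: pZ.
  apply: (etrans (partialD a _ _ x (sZ (j' == l')%:R i') (sZ (i' == l')%:R j'))).
  by congr (_ + _); exact: pZ.
have -> : riemann g l k i j x = dG i l j k - dG j l i k
    + (\sum_p christoffel g l i p x * christoffel g p j k x
    - \sum_p christoffel g l j p x * christoffel g p i k x).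
  by rewrite /riemann sumrB; congr (_ - _ + _); exact: dGE.
rewrite !christoffel_mul_sum /dG (eq_sym j i); move: (grad_dot _ _ _).
by name_atoms R => N; ring.
Qed.

(** The components that carry the sectional curvature of the coordinate planes
    and, summed over both indices, the scalar curvature; the deltas in the general
    formula cancel on the diagonal [i = j]. *)
Lemma riemann_exp_metric_plane i j x : riemann g i j i j x =
  (1 - (i == j)%:R) * (- dd i i x - dd j j x + d i x ^+ 2 + d j x ^+ 2
     - grad_dot phi phi x).
Proof.
rewrite riemann_exp_metric (eq_sym j i) !eqxx.
move: (grad_dot _ _ _) => N; case: eqVneq => [<-|_] /=; name_atoms R; ring.
Qed.

Lemma scalar_curvature_exp_metric x : expR (2 * phi x) * scalar_curvature g x =
  - 2 * (n%:R - 1) * laplacian phi x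
  - (n%:R - 1) * (n%:R - 2) * grad_dot phi phi x.
Proof.
have e0 := expR_gt0 (2 * phi x).
rewrite /scalar_curvature mulr_sumr.
transitivity (\sum_j ricci g j j x).
  apply: eq_bigr => j _; under eq_bigr => k _ do rewrite invmx_exp_metric -mulrA.
  by rewrite sum_deltal mulrA mulfV ?gt_eqF// mul1r.
transitivity (\sum_j \sum_i (1 - (i == j)%:R) *
  ((- dd i i x + d i x ^+ 2) + (- dd j j x + d j x ^+ 2) - grad_dot phi phi x)).
  apply: eq_bigr => j _; apply: eq_bigr => i _.
  rewrite riemann_exp_metric_plane; congr (_ * (_ - _)).
  by name_atoms R; ring.
rewrite (sum_off_diagonal (fun i => - dd i i x + d i x ^+ 2)) big_split /= sumrN.
have -> : \sum_i d i x ^+ 2 = grad_dot phi phi x.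
  by apply: eq_bigr => i _; rewrite expr2.
by rewrite -/(laplacian phi x); move: (grad_dot _ _ _) (laplacian _ _) => N L; ring.
Qed.

Lemma hessian_exp_metric f i j x : hessian g f i j x =
  partial i (partial j f) x - d i x * partial j f x - d j x * partial i f x
  + (i == j)%:R * grad_dot phi f x.
Proof.
rewrite /hessian.
have -> : \sum_k christoffel g k i j x * partial k f x =
    d i x * (\sum_k (j == k)%:R * partial k f x)
  + d j x * (\sum_k (i == k)%:R * partial k f x) - (i == j)%:R * grad_dot phi f x.
  rewrite /grad_dot !mulr_sumr -sumrN -!big_split /=; apply: eq_bigr => k _.
  by rewrite christoffel_exp_metric; name_atoms R; ring.
by rewrite !sum_deltal; move: (grad_dot _ _ _) => N; name_atoms R; ring.
Qed.

Lemma inner_exp_metric x v w : inner g x v w =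
  expR (2 * phi x) * \sum_i v 0 i * w 0 i.
Proof.
rewrite /inner /exp_metric mul_mx_scalar -scalemxAl mxE mxE.
by congr (_ * _); apply: eq_bigr => i _; rewrite mxE.
Qed.

Lemma riemannian_exp_metric : riemannian_metric g.
Proof.
split=> [i j|x|x v v0].
- rewrite (_ : (fun x => _) = fun x => (i == j)%:R * expR (2 * phi x)).
    by apply: smoothZ; exact: smooth_exp2.
  by apply/funext => x; rewrite exp_metricE.
- exact: tr_scalar_mx.
- rewrite inner_exp_metric mulr_gt0 ?expR_gt0// lt_neqAle.
  rewrite sumr_ge0 ?andbT => [|i _]; last by rewrite -expr2 sqr_ge0.
  apply: contra v0; rewrite eq_sym => /eqP vv.
  apply/eqP/rowP => i; rewrite mxE; apply/eqP.
  have := psumr_eq0P (fun i _ => sqr_ge0 (v 0 i)) vv.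
  by move=> /(_ i isT)/eqP; rewrite sqrf_eq0.
Qed.

Lemma row_free_delta_mx i j : i != j ->
  row_free (col_mx (delta_mx 0 i : 'rV[R]_n) (delta_mx 0 j : 'rV[R]_n)).
Proof.
move=> ij; apply/row_freeP.
exists (row_mx (delta_mx i 0 : 'cV[R]_n) (delta_mx j 0 : 'cV[R]_n)).
rewrite mul_col_row !mul_delta_mx_cond !eqxx (negbTE ij) eq_sym (negbTE ij).
have -> : delta_mx 0 0 = 1%:M :> 'M[R]_1 by apply/matrixP => a b; rewrite !ord1 !mxE.
by rewrite !mulr0n !mulr1n -scalar_mx_block.
Qed.

Lemma sectional_curvature_exp_metric i j x : i != j ->
  sectional_curvature g x (delta_mx 0 i) (delta_mx 0 j) =
  (expR (2 * phi x))^-1 * (- dd i i x - dd j j x + d i x ^+ 2 + d j x ^+ 2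
     - grad_dot phi phi x).
Proof.
move=> ij; rewrite /sectional_curvature !inner_exp_metric.
have dot a (w : 'rV[R]_n) : \sum_k w 0 k * (delta_mx 0 a : 'rV[R]_n) 0 k = w 0 a.
  rewrite -[RHS]sum_deltar; apply: eq_bigr => k _.
  by rewrite !mxE eqxx mulrC eq_sym.
rewrite !dot /curvature_op !mxE !eqxx (eq_sym j i) (negbTE ij) /=.
have -> : \sum_i0 \sum_j0 \sum_k riemann g i k i0 j0 x
   * (delta_mx 0 i : 'rV[R]_n) 0 i0 * (delta_mx 0 j : 'rV[R]_n) 0 j0
   * (delta_mx 0 j : 'rV[R]_n) 0 k = riemann g i j i j x.
  transitivity (\sum_i0 (i0 == i)%:R * \sum_j0 (j0 == j)%:R *
     \sum_k (k == j)%:R * riemann g i k i0 j0 x).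
    apply: eq_bigr => a _; rewrite mulr_sumr; apply: eq_bigr => b _.
    rewrite !mulr_sumr; apply: eq_bigr => c _; rewrite !mxE !eqxx /=.
    by move: (riemann _ _ _ _ _ _) => r; name_atoms R; ring.
  by rewrite !sum_deltar.
rewrite riemann_exp_metric_plane (negbTE ij) /=.
by have := expR_gt0 (2 * phi x); move: (grad_dot _ _ _) => N; name_atoms R => e0;
field; rewrite gt_eqF.
Qed.

End ConformallyFlat.

(** * Radial functions *)

Section Radial.
Context {R : realType} {n : nat}.
Implicit Types (f : 'rV[R]_n -> R) (x y v : 'rV[R]_n) (i j k : 'I_n).

Lemma partial_coordM i j [f x] : differentiable f x ->
  partial i (fun y => y 0 j * f y) x = (i == j)%:R * f x + x 0 j * partial i f x.
Proof.
move=> df; rewrite (partialM i _ _ x (differentiable_coord x 0 j) df).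
by rewrite partial_coord.
Qed.

(** The squared Euclidean norm: unlike [enorm] it is smooth at the origin. *)
Definition sqn x : R := \sum_i x 0 i ^+ 2.

Definition radial f := forall x y, sqn x = sqn y -> f x = f y.

(** The Euler field [x . grad f], that is [r f'(r)] for a radial [f]. *)
Definition euler f x : R := \sum_i x 0 i * partial i f x.

Lemma sqn_ge0 x : 0 <= sqn x.
Proof. by apply: sumr_ge0 => i _; exact: sqr_ge0. Qed.

Lemma sqn_eq0 [x] : sqn x = 0 -> x = 0.
Proof.
move=> x0; apply/rowP => i; rewrite mxE; apply/eqP; rewrite -sqrf_eq0.
by apply/eqP; apply: (psumr_eq0P _ x0) => // j _; exact: sqr_ge0.
Qed.

Lemma sqnZ (c : R) x : sqn (c *: x) = c ^+ 2 * sqn x.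
Proof. by rewrite mulr_sumr; apply: eq_bigr => i _; rewrite mxE exprMn. Qed.

Lemma sqn_delta i : sqn (delta_mx 0 i) = 1.
Proof.
rewrite /sqn (bigD1 i)//= big1 ?addr0 => [|j ji]; rewrite mxE eqxx.
  by rewrite eqxx expr1n.
by rewrite (negbTE ji) expr0n.
Qed.

Lemma rotationally_symmetric_radial f : rotationally_symmetric f -> radial f.
Proof. by case=> h fE x y; rewrite !fE /enorm -!/(sqn _) => ->. Qed.

Lemma eulerE f x : differentiable f x -> 'D_x f x = euler f x.
Proof. exact: derive_partialE. Qed.

Lemma smooth_euler [f] : smooth f -> smooth (euler f).
Proof.
move=> sf; apply: smooth_sum => i; apply: smoothM; first exact: smooth_coord.
exact: smooth_partial.
Qed.

(** [euler f x] is the derivative of [f] at [x] along [x] itself, and the points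
    [x + h x] have norm [|1 + h| |x|], so the whole difference quotient depends on
    [x] only through [|x|]. *)
Lemma radial_euler [f] : smooth f -> radial f -> radial (euler f).
Proof.
move=> sf rf x y xy.
rewrite -!eulerE; try exact: smooth_differentiable.
rewrite /derive (rf _ _ xy).
suff -> : (fun h : R => h^-1 *: ((f \o shift x) (h *: x) - f y)) =
   (fun h : R => h^-1 *: ((f \o shift y) (h *: y) - f y)) by [].
apply/funext => h /=; congr (_ *: (_ - _)); apply: rf.
by rewrite -[in LHS](scale1r x) -[in RHS](scale1r y) !scalerA mulr1 -!scalerDl
  !sqnZ xy.
Qed.

(** If [v] is orthogonal to [x] then [x + h v] and [x - h v] have the same norm:
    [f] is even along this line, so its derivative there vanishes. *)
Lemma radial_derive_orthogonal [f x v] : smooth f -> radial f ->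
  \sum_i v 0 i * x 0 i = 0 -> 'D_v f x = 0.
Proof.
move=> sf rf vx.
have E : 'D_(- v) f x = 'D_v f x.
  rewrite /derive.
  suff -> : (fun h : R => h^-1 *: ((f \o shift x) (h *: - v) - f x)) =
     (fun h : R => h^-1 *: ((f \o shift x) (h *: v) - f x)) by [].
  apply/funext => h /=; congr (_ *: (_ - _)); apply: rf.
  have sq (c : R) : sqn (c *: v + x) = c ^+ 2 * sqn v + sqn x.
    transitivity (\sum_i (c ^+ 2 * v 0 i ^+ 2 + x 0 i ^+ 2
                          + 2 * c * (v 0 i * x 0 i))).
      by apply: eq_bigr => i _; rewrite !mxE; ring.
    by rewrite !big_split /= -!mulr_sumr vx mulr0 addr0.
  by rewrite scalerN -scaleNr !sq sqrrN.
have df := smooth_differentiable x sf.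
move: E; rewrite !deriveE// linearN /= => /eqP.
by rewrite eq_sym -subr_eq0 opprK -mulr2n mulrn_eq0 /= => /eqP.
Qed.

Context {phi : 'rV[R]_n -> R}.
Hypotheses (sphi : smooth phi) (rphi : radial phi).
Local Notation d i := (partial i phi).
Local Notation dd i j := (partial i (partial j phi)).
Local Notation N := (grad_dot phi phi).

(** Rotations in the plane of [x_i], [x_j] fix [phi]. *)
Lemma radial_rotation i j x : x 0 j * d i x = x 0 i * d j x.
Proof.
pose v : 'rV[R]_n := x 0 j *: delta_mx 0 i - x 0 i *: delta_mx 0 j.
have vk (k : 'I_n) : v 0 k = (k == i)%:R * x 0 j - (k == j)%:R * x 0 i.
  by rewrite !mxE eqxx /= mulrC [_ * x 0 i]mulrC.
have sumv (F : 'I_n -> R) : \sum_k v 0 k * F k = x 0 j * F i - x 0 i * F j.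
  rewrite -(sum_deltar F i) -(sum_deltar F j) !mulr_sumr -sumrB.
  by apply: eq_bigr => k _; rewrite vk; ring.
have := @radial_derive_orthogonal phi x v sphi rphi.
rewrite sumv mulrC subrr => /(_ erefl).
rewrite derive_partialE; last exact: smooth_differentiable.
by rewrite sumv => /eqP; rewrite subr_eq0 => /eqP.
Qed.

Lemma radial_grad_sq x : sqn x * N x = euler phi x ^+ 2.
Proof.
rewrite expr2 /sqn /grad_dot /euler !mulr_suml; apply: eq_bigr => i _.
rewrite !mulr_sumr; apply: eq_bigr => j _.
have A (a b p q : R) : a * q = b * p -> a ^+ 2 * (q * q) = a * p * (b * q).
  by move=> E; transitivity ((a * q) * (a * q)); [ring | rewrite {2}E; ring].
exact/A/radial_rotation.
Qed.

Lemma partial_euler i x :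
  partial i (euler phi) x = d i x + \sum_j x 0 j * dd i j x.
Proof.
have dc (j : 'I_n) := differentiable_coord x 0 j.
have dp (j : 'I_n) := smooth_differentiable x (smooth_partial j sphi).
rewrite [LHS]/partial (_ : euler phi = \sum_j (fun y => y 0 j * d j y)); last first.
  by apply/funext => y; rewrite fct_sumE.
rewrite derive_sum => [|j]; last exact/diff_derivable/differentiableM.
rewrite -(sum_deltal (fun j => d j x) i) -big_split /=; apply: eq_bigr => j _.
exact: partial_coordM.
Qed.

Lemma radial_rotation_partial i j x :
  d j x + x 0 i * dd i j x = (i == j)%:R * d i x + x 0 j * dd i i x.
Proof.
have dp (k : 'I_n) := smooth_differentiable x (smooth_partial k sphi).
have one_mul (a b : R) : (i == i)%:R * a + b = a + b by rewrite eqxx mul1r.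
apply: (etrans (esym (one_mul _ _))).
apply: (etrans (esym (partial_coordM i i (dp j)))).
apply: (etrans _ (partial_coordM i j (dp i))).
exact: (congr1 (fun h => partial i h x) (funext (radial_rotation j i))).
Qed.

(** The polar form [phi'' + (n - 1) phi' / r] of the Laplacian, multiplied by
    [r ^ 2]: it follows by differentiating the rotation identity and contracting
    with [x]. It reduces the radiality of the Laplacian to that of [euler]. *)
Lemma radial_laplacian_euler x :
  sqn x * laplacian phi x = (n%:R - 2) * euler phi x + euler (euler phi) x.
Proof.
have EE : euler (euler phi) x =
    euler phi x + \sum_i \sum_j x 0 j * (x 0 i * dd i j x).
  rewrite /euler -big_split /=; apply: eq_bigr => i _.
  rewrite partial_euler mulrDr; congr (_ + _); rewrite mulr_sumr.
  by apply: eq_bigr => j _; rewrite mulrCA.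
have E : n%:R * euler phi x + \sum_i \sum_j x 0 j * (x 0 i * dd i j x) =
    euler phi x + sqn x * laplacian phi x.
  transitivity (\sum_i \sum_j x 0 j * (d j x + x 0 i * dd i j x)).
    rewrite (_ : n%:R * _ = \sum_(i < n) euler phi x); last first.
      by rewrite sumr_const card_ord mulr_natl.
    rewrite -big_split /=; apply: eq_bigr => i _; rewrite -big_split /=.
    by apply: eq_bigr => j _; rewrite mulrDr.
  transitivity (\sum_i \sum_j ((i == j)%:R * (x 0 j * d i x)
                                + x 0 j ^+ 2 * dd i i x)).
    apply: eq_bigr => i _; apply: eq_bigr => j _.
    by rewrite radial_rotation_partial; name_atoms R; ring.
  rewrite /laplacian mulr_sumr -big_split /=; apply: eq_bigr => i _.
  by rewrite big_split /= (sum_deltal (fun j => x 0 j * d i x)) -mulr_suml.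
rewrite EE; apply: (addrI (euler phi x)); rewrite -E.
move: (euler phi x) (\sum_i _) => k S; ring.
Qed.

Lemma radial_laplacian : radial (laplacian phi).
Proof.
move=> x y xy; have [x0|x0] := eqVneq (sqn x) 0.
  by rewrite (sqn_eq0 x0) (@sqn_eq0 y)// -xy.
apply: (mulfI x0); rewrite {2}xy !radial_laplacian_euler.
have se := smooth_euler sphi; have re := radial_euler sphi rphi.
by rewrite (re _ _ xy) (radial_euler se re _ _ xy).
Qed.

Lemma radial_grad_dot : radial N.
Proof.
move=> x y xy; have [x0|x0] := eqVneq (sqn x) 0.
  by rewrite (sqn_eq0 x0) (@sqn_eq0 y)// -xy.
apply: (mulfI x0); rewrite {2}xy !radial_grad_sq.
by rewrite (radial_euler sphi rphi _ _ xy).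
Qed.

End Radial.

(** * Monotonicity along a ray *)

Section RealLine.
Context {R : realType}.

Lemma is_derive_continuous (f : R -> R) (t df : R) :
  is_derive t 1 f df -> {for t, continuous f}.
Proof.
by case=> df1 _; exact/differentiable_continuous/derivable1_diffP.
Qed.

Lemma is_derive_unique {f : R -> R} {t a b : R} :
  is_derive t 1 f a -> is_derive t 1 f b -> a = b.
Proof. by move=> [_ <-] [_ <-]. Qed.

Lemma mean_value (f f' : R -> R) (a b : R) : a < b ->
  (forall t, a <= t -> is_derive t 1 f (f' t)) ->
  exists2 c, a < c < b & f b - f a = f' c * (b - a).
Proof.
move=> ab df; have [||c] := @MVT R f f' a b ab.
- by move=> t; rewrite in_itv /= => /andP[/ltW at_ _]; exact: df.
- apply: continuous_in_subspaceT => t.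
  by rewrite inE /= in_itv /= => /andP[/df/is_derive_continuous].
by rewrite in_itv; exists c.
Qed.

Lemma derive_le0_nonincreasing (f f' : R -> R) (a : R) :
  (forall t, a <= t -> is_derive t 1 f (f' t)) ->
  (forall t, a <= t -> f' t <= 0) ->
  forall s t, a <= s -> s <= t -> f t <= f s.
Proof.
move=> df f'0 s t as_; rewrite le_eqVlt => /predU1P[->//|st].
have [|c /andP[sc _] E] := @mean_value f f' s t st.
  by move=> r sr; apply: df; exact: le_trans sr.
rewrite -subr_le0 E mulr_le0_ge0 ?subr_ge0 ?(ltW st)//.
by apply: f'0; rewrite (le_trans as_)// ltW.
Qed.

Section PointwiseRules.
Context {f g : R -> R} {t df dg : R}.
Hypotheses (Hf : is_derive t 1 f df) (Hg : is_derive t 1 g dg).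

Lemma is_derive_add : is_derive t 1 (fun s => f s + g s) (df + dg).
Proof. exact: is_deriveD. Qed.

Lemma is_derive_mul : is_derive t 1 (fun s => f s * g s) (df * g t + f t * dg).
Proof.
have H := is_deriveM Hf Hg; apply: (is_derive_eq H).
by rewrite /GRing.scale /= addrC [g t * df]mulrC.
Qed.

Lemma is_derive_exprn (m : nat) :
  is_derive t 1 (fun s => f s ^+ m.+1) (m.+1%:R * f t ^+ m * df).
Proof.
rewrite (_ : (fun s => f s ^+ m.+1) = (@GRing.exp R ^~ m.+1) \o f)//.
apply: is_derive1_comp; apply: DeriveDef; first exact: exprn_derivable.
by rewrite exp_derive /GRing.scale /= mulr1.
Qed.

Lemma is_derive_exp : is_derive t 1 (fun s => expR (f s)) (expR (f t) * df).
Proof. exact: is_derive1_comp. Qed.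
End PointwiseRules.

Lemma is_derive_scale (a : R) {f : R -> R} {t df : R} :
  is_derive t 1 f df -> is_derive t 1 (fun s => a * f s) (a * df).
Proof. by move=> H; exact: is_deriveZ. Qed.

(** The radial analysis behind [beta >= 0]. Here [ph] is the profile of a radial
    conformal factor along a ray, [psi] the radius of the geodesic spheres, and
    [y] its derivative with respect to arc length, so that the ordinary
    differential equation says [R = rho + c y]; [y1 <= 0] and [y ^ 2 <= 1] express
    that the radial and the tangential sectional curvatures are nonnegative.
    Suppose [c < 0].

    The function [M = psi ^ (n - 2) (1 - y ^ 2) - rho psi ^ n / (n (n - 1))]
    vanishes at the origin and has derivative [c y ^ 2 psi ^ (n - 1) e ^ ph / (n - 1)],
    hence it becomes and stays negative; as its first term is nonnegative, [psi]
    stays away from [0].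
    Replacing [rho] by [rho + c y] gives [W], whose derivative
    [- c y1 psi ^ n / (n (n - 1))] is nonpositive too; [W <= 0] and the equation give
    [t y1 <= - k psi ^ 2] with [k > 0]. The two facts together make [y] decrease at
    least like a negative multiple of [ln t], which contradicts [y >= -1]. *)
Lemma profile_contradiction (m : nat) (c rho : R) (ph p p1 : R -> R) :
  let n : R := m.+3%:R in
  let y (t : R) := 1 + t * p t in
  let y1 (t : R) := p t + t * p1 t in
  let psi (t : R) := t * expR (ph t) in
  c < 0 -> 0 < rho -> 0 < rho + c ->
  (forall t : R, is_derive t 1 ph (p t)) ->
  (forall t : R, is_derive t 1 p (p1 t)) ->
  (forall t : R, psi t ^+ 2 * (rho + c * y t) =
     - 2 * (n - 1) * (t * y1 t) + (n - 1) * (n - 2) * (1 - y t ^+ 2)) ->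
  (forall t : R, 0 <= t -> y1 t <= 0) ->
  (forall t : R, 0 <= t -> y t ^+ 2 <= 1) ->
  False.
Proof.
move=> n y y1 psi c0 rho0 rc0 dph dp ode y1le0 y2le1.
pose e (t : R) := expR (ph t).
have e_gt0 t : 0 < e t by exact: expR_gt0.
have n_ge3 : 3 <= n by rewrite /n ler_nat.
have nE : n = m%:R + 3 by rewrite /n -natrD addn3.
have dy (t : R) : is_derive t 1 y (y1 t).
  have H := is_derive_add (is_derive_cst (1 : R) t 1)
    (is_derive_mul (is_derive_id t 1) (dp t)).
  apply: (is_derive_eq H).
  by rewrite /y1 add0r mul1r.
have dpsi (t : R) : is_derive t 1 psi (e t * y t).
  have H := is_derive_mul (is_derive_id t 1) (is_derive_exp (dph t)).
  apply: (is_derive_eq H).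
  by rewrite /y /e /=; ring.
pose K := (n * (n - 1))^-1.
have K0 : 0 < K by rewrite invr_gt0; nra.
pose M (t : R) := psi t ^+ m.+1 * (1 + -1 * y t ^+ 2) + - (rho * K) * psi t ^+ m.+3.
pose M' (t : R) := c / (n - 1) * (psi t ^+ m.+2 * e t * y t ^+ 2).
have dM (t : R) : is_derive t 1 M (M' t).
  have Hy := is_derive_add (is_derive_cst (1 : R) t 1)
    (is_derive_scale (-1) (is_derive_exprn (dy t) 1)).
  have H := is_derive_add (is_derive_mul (is_derive_exprn (dpsi t) m) Hy)
    (is_derive_scale (- (rho * K)) (is_derive_exprn (dpsi t) m.+2)).
  apply: (is_derive_eq H).
  have n1 : m.+1%:R = m%:R + 1 :> R by rewrite -natr1.
  have n3 : m.+3%:R = m%:R + 3 :> R by rewrite -/n nE.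
  rewrite /M' /K expr1 !(exprS (psi t)) n1 n3 -/(psi t).
  have := ode t.
  move: nE (erefl (psi t)); rewrite {2}/psi -/(e t).
  move: (psi t) (e t) (y t) (y1 t) (psi t ^+ m) => P E Y Y1 A -> PE.
  rewrite PE => /eqP; rewrite -subr_eq0 => /eqP od.
  have m0 : 0 <= m%:R :> R by rewrite ler0n.
  move: (m%:R) m0 od => r r0 od.
  apply/eqP; rewrite -subr_eq0.
  rewrite (_ : _ - _ = - (A * E * Y / (r + 2)) * ((t * E) ^+ 2 * (rho + c * Y) -
   (-2 * (r + 3 - 1) * (t * Y1) + (r + 3 - 1) * (r + 3 - 2) * (1 - Y ^+ 2)))).
    by rewrite od mulr0.
  rewrite /cst /=.
field; do ?(apply/andP; split); apply/eqP; nra.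
have psi_ge0 t : 0 <= t -> 0 <= psi t by move=> t0; rewrite mulr_ge0 ?expR_ge0.
have psi_gt0 t : 0 < t -> 0 < psi t by move=> t0; rewrite mulr_gt0 ?expR_gt0.
have M'le0 t : 0 <= t -> M' t <= 0.
  move=> t0; rewrite /M' mulr_le0_ge0 ?mulr_le0_ge0 ?invr_ge0 ?(ltW c0)//.
    by rewrite subr_ge0; lra.
  apply: mulr_ge0; last exact: sqr_ge0.
  by apply: mulr_ge0; [apply: exprn_ge0; exact: psi_ge0 | exact: ltW].
have y_le1 t : 0 <= t -> y t <= 1.
  by move=> t0; have := y2le1 t t0; move: (y t) => Y; nra.
have M0 : M 0 = 0 by rewrite /M /psi mul0r !expr0n /= mul0r mulr0 addr0.
have psi00 : psi 0 = 0 by rewrite /psi mul0r.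
(* the radial sectional curvature is bounded below by [K (rho + c)] *)
have pinch t : 0 < t -> t * y1 t <= - (K * (rho + c)) * psi t ^+ 2.
  move=> t0.
  pose W s := M s + (- (c * K)) * (y s * psi s ^+ m.+3).
  pose W' s := - (c * K) * (y1 s * psi s ^+ m.+3).
  have dW (s : R) : is_derive s 1 W (W' s).
    have H := is_derive_add (dM s) (is_derive_scale (- (c * K))
      (is_derive_mul (dy s) (is_derive_exprn (dpsi s) m.+2))).
    apply: (is_derive_eq H); rewrite /M' /W' /K -/n !exprS.
    have n0 : 0 < n by lra.
    have n1 : 0 < n - 1 by lra.
    by move: (psi s ^+ m) => A; field; rewrite ?gt_eqF.
  have := @derive_le0_nonincreasing W W' 0 (fun s _ => dW s) _ 0 t (lexx 0) (ltW t0).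
  rewrite {2}/W M0 psi00 expr0n /= !mulr0 addr0 => Wle.
  have {}Wle : W t <= 0.
    apply: Wle => s s0; rewrite /W' mulr_ge0_le0 //.
      by rewrite oppr_ge0 mulr_le0_ge0 // ltW.
    by rewrite mulr_le0_ge0 ?y1le0// exprn_ge0// psi_ge0.
  have WE : W t = psi t ^+ m.+1 * (1 - y t ^+ 2 - (rho + c * y t) * K * psi t ^+ 2).
    by rewrite /W /M !(exprS _ m.+2) !(exprS _ m.+1); ring.
  move: Wle; rewrite WE pmulr_rle0 ?exprn_gt0 ?psi_gt0// => Wle.
  have := ode t; have := y_le1 t (ltW t0); move: Wle.
  have := sqr_ge0 (psi t).
  have nK : n * (n - 1) * K = 1 by rewrite mulfV// gt_eqF//; nra.
  move: (psi t ^+ 2) (y t) (t * y1 t) => P Y T P0 W1 Y1 od.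
  have B : (n - 1) * (n - 2) * (1 - Y ^+ 2) <= (n - 1) * (n - 2) * ((rho + c * Y) * K * P).
    rewrite ler_wpM2l //; last by lra.
    by apply: mulr_ge0; lra.
  have C : 2 * (n - 1) * T <= 2 * (n - 1) * (- (K * (rho + c * Y)) * P).
    rewrite (_ : 2 * (n - 1) * (- _ * P) =
      (n - 1) * (n - 2) * ((rho + c * Y) * K * P)
      - n * (n - 1) * K * (P * (rho + c * Y))); last by ring.
    by rewrite nK mul1r od; lra.
  move: C; rewrite ler_pM2l; last by lra.
  move=> /le_trans; apply; rewrite ler_wpM2r// lerN2 ler_wpM2l ?(ltW K0)//.
  by rewrite lerD2l; nra.
have [t1 t1_gt0 Mt1] : exists2 t1, 0 < t1 & M t1 < 0.
  have y0 : y 0 = 1 by rewrite /y mul0r addr0.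
  have /cvgrPdist_lt/(_ 1 ltr01) : {for 0, continuous y}.
    exact: is_derive_continuous (dy 0).
  move=> /nbhs_ballP[d /= d0 yd].
  exists (d / 2); first by rewrite divr_gt0.
  have [|s /andP[s0 sd]] := @mean_value M M' 0 (d / 2) _ (fun s _ => dM s).
    by rewrite divr_gt0.
  rewrite M0 !subr0 => ->; rewrite pmulr_llt0 ?divr_gt0//.
  have ys : 0 < y s.
    have : ball 0 d s.
      by rewrite /ball /= sub0r normrN gtr0_norm//; lra.
    by move=> /yd; rewrite y0 ltr_norml => /andP[_]; lra.
  have cn0 : c / (n - 1) < 0 by rewrite pmulr_llt0// invr_gt0; lra.
  rewrite /M' nmulr_rlt0//; apply: mulr_gt0; last exact: exprn_gt0.
  by apply: mulr_gt0 => //; apply: exprn_gt0; exact: psi_gt0.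
pose eps := - M t1 / (rho * K).
have eps0 : 0 < eps by rewrite divr_gt0 ?oppr_gt0 ?mulr_gt0.
have psi_far t : t1 <= t -> eps <= psi t ^+ m.+3.
  move=> t1t; have t0 : 0 <= t by lra.
  have Mt : M t <= M t1.
    apply: (@derive_le0_nonincreasing M M' t1) => // s ts; apply: M'le0; lra.
  rewrite ler_pdivrMr ?mulr_gt0//.
  have : 0 <= psi t ^+ m.+1 * (1 + -1 * y t ^+ 2).
    rewrite mulr_ge0 ?exprn_ge0 ?psi_ge0//; have := y2le1 t t0; lra.
  by move: Mt; rewrite {1}/M; lra.
pose del := Num.min 1 eps.
have del0 : 0 < del by rewrite lt_min ltr01.
(* [psi ^ 2 >= psi ^ n] if [psi <= 1], and [psi ^ 2 >= 1] otherwise *)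
have psi_del t : t1 <= t -> del <= psi t ^+ 2.
  move=> t1t; have t0 : 0 <= t by lra.
  have [p1t|p1t] := leP 1 (psi t).
    by rewrite ge_min exprn_ege1.
  rewrite ge_min; apply/orP; right; apply: (le_trans (psi_far t t1t)).
  by rewrite ler_wiXn2l ?psi_ge0// ltW.
pose k := K * (rho + c) * del.
have k0 : 0 < k by rewrite !mulr_gt0.
pose L t := y t + k * ln t.
pose L' t := y1 t + k * t^-1.
have L'le0 t : t1 <= t -> L' t <= 0.
  move=> t1t; have t0 : 0 < t by lra.
  rewrite -(pmulr_rle0 _ t0) mulrDr mulrCA mulfV ?gt_eqF// mulr1.
  have := pinch t t0; have := psi_del t t1t.
  have : 0 <= K * (rho + c) by rewrite mulr_ge0// ltW.
  rewrite /k; nra.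
have dL (t : R) : t1 <= t -> is_derive t 1 L (L' t).
  move=> t1t; have t0 : 0 < t by lra.
  exact: (is_derive_add (dy t) (is_derive_scale k (is_derive1_ln t0))).
(* at [t2] the logarithmic bound has pushed [y] down to at most [-2] *)
pose t2 := t1 * expR (3 / k).
have t12 : t1 <= t2.
  by rewrite ler_peMr ?(ltW t1_gt0)// -expR0 ler_expR divr_ge0// ltW.
have := @derive_le0_nonincreasing L L' t1 dL L'le0 t1 t2 (lexx _) t12.
rewrite /L lnM ?posrE ?expR_gt0// expRK mulrDr mulrCA mulfV ?gt_eqF// mulr1.
have := y_le1 t1 (ltW t1_gt0); have := y2le1 t2 (le_trans (ltW t1_gt0) t12).
by move: (y t1) (y t2) => Y1 Y2; nra.
Qed.

End RealLine.

(** * The soliton equation on an axis *)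

Lemma is_derive_reflect {R : realType} {f : R -> R} {t df : R} :
  is_derive (- t) 1 f df -> is_derive t 1 (fun s => f (- s)) (- df).
Proof.
move=> H; have N := is_deriveNid t (1 : R).
have -> : - df = df * -1 by rewrite mulrN1.
exact: (@is_derive1_comp _ f -%R).
Qed.

Section Axis.
Context {R : realType} {n : nat} (i0 : 'I_n) (phi : 'rV[R]_n -> R).
Hypotheses (sphi : smooth phi) (rphi : radial phi).
Implicit Types (t : R) (i j : 'I_n).
Local Notation d i := (partial i phi).
Local Notation dd i j := (partial i (partial j phi)).

Definition axis t : 'rV[R]_n := t *: delta_mx 0 i0.

Lemma axisE t i : axis t 0 i = (i == i0)%:R * t.
Proof. by rewrite !mxE eqxx mulrC. Qed.

Lemma sqn_axis t : sqn (axis t) = t ^+ 2.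
Proof. by rewrite sqnZ sqn_delta mulr1. Qed.

Lemma radial_axisN f t : radial f -> f (axis (- t)) = f (axis t).
Proof. by apply; rewrite !sqn_axis sqrrN. Qed.

Lemma is_derive_axis [f] t : smooth f ->
  is_derive t 1 (fun s => f (axis s)) (partial i0 f (axis t)).
Proof. by move=> sf; apply: is_derive_line; exact: smooth_differentiable. Qed.

Lemma axis_partial j t : j != i0 -> d j (axis t) = 0.
Proof.
move=> ji; apply: (radial_derive_orthogonal sphi rphi).
rewrite big1 // => k _; rewrite axisE !mxE eqxx /=.
by case: eqVneq => [->|_]; rewrite ?(negbTE ji) ?mul0r ?mulr0.
Qed.

Lemma axis_partial0 : d i0 (axis 0) = 0.
Proof.
apply: (radial_derive_orthogonal sphi rphi).
by rewrite big1 // => k _; rewrite axisE !mulr0.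
Qed.

Lemma axis_euler t : euler phi (axis t) = t * d i0 (axis t).
Proof.
rewrite /euler -(sum_deltar (fun i => t * d i (axis t))).
by apply: eq_bigr => i _; rewrite axisE mulrA.
Qed.

Lemma axis_partialN t : d i0 (axis (- t)) = - d i0 (axis t).
Proof.
have [->|t0] := eqVneq t 0; first by rewrite oppr0 axis_partial0 oppr0.
apply: (mulfI t0); apply: oppr_inj; rewrite -mulNr -axis_euler.
by rewrite mulrN opprK -axis_euler; exact/radial_axisN/radial_euler.
Qed.

Lemma axis_grad_dot f t :
  grad_dot phi f (axis t) = d i0 (axis t) * partial i0 f (axis t).
Proof.
rewrite /grad_dot (bigD1 i0)//= big1 ?addr0// => j ji.
by rewrite axis_partial ?mul0r.
Qed.

Lemma axis_partial2 [j] t : j != i0 -> t * dd j j (axis t) = d i0 (axis t).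
Proof.
move=> ji; have := radial_rotation_partial sphi rphi j i0 (axis t).
rewrite !axisE eqxx (negbTE ji) !mul0r mul1r add0r addr0.
by move=> ->.
Qed.

Lemma axis_partial2N j t : j != i0 -> dd j j (axis (- t)) = dd j j (axis t).
Proof.
move=> ji; have [->|t0] := eqVneq t 0; first by rewrite oppr0.
apply: (mulfI t0); apply: oppr_inj.
apply: (etrans (esym (mulNr _ _))); apply: (etrans (axis_partial2 (- t) ji)).
by rewrite axis_partialN; congr (- _); exact/esym/axis_partial2.
Qed.

(** [phi_j] vanishes along the whole axis, hence so does its derivative along it. *)
Lemma axis_partial_mixed j t : j != i0 -> dd j i0 (axis t) = 0.
Proof.
move=> ji; rewrite partial_comm//.
have H := is_derive_axis t (smooth_partial j sphi).
have E : (fun s : R => d j (axis s)) = cst 0.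
  by apply/funext => s; rewrite axis_partial.
rewrite E in H; exact: (is_derive_unique H (is_derive_cst (0 : R) t 1)).
Qed.

Lemma axis_laplacian t : t * laplacian phi (axis t) =
  t * dd i0 i0 (axis t) + (n%:R - 1) * d i0 (axis t).
Proof.
rewrite /laplacian (bigD1 i0)//= mulrDr mulr_sumr; congr (_ + _).
rewrite (eq_bigr (fun _ => d i0 (axis t))) => [|j ji]; last exact: axis_partial2.
have nE : n%:R - 1 = #|predC1 i0|%:R :> R.
  have n0 : (0 < n)%N by exact: leq_trans (ltn_ord i0).
  by rewrite cardC1 card_ord -[X in X%:R - 1](prednK n0) -natr1 addrK.
by rewrite sumr_const nE mulr_natl.
Qed.

(** Differentiate [t phi_jj = phi_0] along the axis at [t = 0]. *)
Lemma axis_partial2_origin j : dd j j (axis 0) = dd i0 i0 (axis 0).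
Proof.
have [->//|ji] := eqVneq j i0.
have H : is_derive (0 : R) 1 (fun s => s * dd j j (axis s))
    (1 * dd j j (axis 0) + 0 * partial i0 (dd j j) (axis 0)).
  apply: (is_derive_mul (is_derive_id (0 : R) 1)); apply: is_derive_axis.
  by do 2 apply: smooth_partial.
have H0 := is_derive_axis 0 (smooth_partial i0 sphi).
have E : (fun s : R => s * dd j j (axis s)) = (fun s => d i0 (axis s)).
  by apply/funext => s; exact: axis_partial2.
rewrite E in H; have := is_derive_unique H H0.
by rewrite mul1r mul0r addr0.
Qed.

(** The potential [f] of the soliton need not be radial: the radial
    part of its gradient is isolated by a symmetrization along one axis.

    Write [p = phi_0], [F = f_0], [H = f_11] on the axis. Differentiating the
    off-diagonal equation [f_01 = phi_0 f_1 + phi_1 f_0] in the direction [1] gives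
    [H' = p H + phi_11 F], and comparing the two diagonal equations gives
    [f_00 = H + 2 p F]. Therefore [E = t H - F] satisfies [E' = p E], that is
    [E = E(0) e ^ (phi - phi(0))], an even function of [t]. So in the
    symmetrization [K(t) = H(t) + H(-t)] the contribution of [E] drops out of
    [F(t) - F(-t) = t K(t)], and [K' = 2 p K] makes [K] a constant multiple of
    [e ^ (2 phi)]. Finally [T] is even and equals [H + p F]. *)
Lemma axis_soliton (i1 : 'I_n) (f T : 'rV[R]_n -> R) : i1 != i0 ->
  smooth f -> radial T ->
  (forall x i j, (i == j)%:R * T x = partial i (partial j f) x
     - d i x * partial j f x - d j x * partial i f x
     + (i == j)%:R * grad_dot phi f x) ->
  exists c, forall t,
    T (axis t) = c * expR (2 * phi (axis t)) * (1 + t * d i0 (axis t)).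
Proof.
move=> i10 sf rT eqT.
pose p t := d i0 (axis t).
pose q t := dd i1 i1 (axis t).
pose F t := partial i0 f (axis t).
pose F2 t := partial i0 (partial i0 f) (axis t).
pose H t := partial i1 (partial i1 f) (axis t).
have B1 t : T (axis t) = F2 t - p t * F t.
  have := eqT (axis t) i0 i0; rewrite eqxx !mul1r axis_grad_dot => ->.
  by rewrite -/(p t) -/(F t) -/(F2 t); ring.
have B2 t : T (axis t) = H t + p t * F t.
  have := eqT (axis t) i1 i1; rewrite eqxx !mul1r axis_grad_dot => ->.
  by rewrite axis_partial// mul0r !subr0.
have B3 : partial i0 (partial i1 f) =
    fun x => d i0 x * partial i1 f x + d i1 x * partial i0 f x.
  apply/funext => x; have := eqT x i0 i1.
  rewrite eq_sym (negbTE i10) !mul0r addr0 => /esym/eqP.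
  by rewrite -addrA -opprD subr_eq0 => /eqP.
have dF (t : R) : is_derive t 1 F (F2 t) by exact/is_derive_axis/smooth_partial.
have dH (t : R) : is_derive t 1 H (p t * H t + q t * F t).
  have := is_derive_axis t (smooth_partial i1 (smooth_partial i1 sf)).
  rewrite partial_comm; last exact: smooth_partial.
  rewrite B3.
  have dd1 k (h : 'rV[R]_n -> R) : smooth h -> differentiable (partial k h) (axis t).
    by move=> sh; apply: smooth_differentiable; exact: smooth_partial.
  have E0 := partialM i1 _ _ _ (dd1 i0 phi sphi) (dd1 i1 f sf).
  have E1 := partialM i1 _ _ _ (dd1 i1 phi sphi) (dd1 i0 f sf).
  have E := partialD i1 _ _ _ (differentiableM (dd1 i0 phi sphi) (dd1 i1 f sf))
     (differentiableM (dd1 i1 phi sphi) (dd1 i0 f sf)).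
  move=> D; apply: (is_derive_eq D); apply: (etrans E).
  apply: (etrans (congr2 +%R E0 E1)).
  rewrite (axis_partial_mixed i1 t i10) (axis_partial i1 t i10).
  by rewrite [X in X + _ + _]mul0r add0r [X in _ + (_ + X)]mul0r addr0.
have dphi (t : R) : is_derive t 1 (fun s => phi (axis s)) (p t).
  exact: is_derive_axis.
have tq t : t * q t = p t by exact: axis_partial2.
have pN t : p (- t) = - p t by exact: axis_partialN.
have qN t : q (- t) = q t by exact: axis_partial2N.
have phiN t : phi (axis (- t)) = phi (axis t) by exact: radial_axisN.
suff [c cE] : exists c, forall t,
    T (axis t) = c * expR (2 * phi (axis t)) * (1 + t * p t) by exists c.
clearbody p q F F2 H.
pose E t := t * H t + -1 * F t.
have EN t : E (- t) = E t.
  pose Z t := E t * expR (-1 * phi (axis t)).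
  have dZ (s : R) : is_derive s 1 Z 0.
    have D := is_derive_mul (is_derive_add (is_derive_mul (is_derive_id s 1) (dH s))
      (is_derive_scale (-1) (dF s))) (is_derive_exp (is_derive_scale (-1) (dphi s))).
    apply: (is_derive_eq D); have := B1 s; rewrite B2 => B.
    have -> : F2 s = H s + 2 * p s * F s by move: B; lra.
    rewrite -(tq s); move: (expR _) => e; ring.
  have := @is_derive_0_is_cst _ Z (- t) t dZ; rewrite /Z phiN.
  by move/mulIf; apply; rewrite expR_eq0.
pose K t := H t + H (- t).
have FK t : F t - F (- t) = t * K t.
  by have := EN t; rewrite /E /K; lra.
pose Y t := K t * expR (-2 * phi (axis t)).
have dY (s : R) : is_derive s 1 Y 0.
  have D := is_derive_mul (is_derive_add (dH s) (is_derive_reflect (dH (- s))))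
    (is_derive_exp (is_derive_scale (-2) (dphi s))).
  apply: (is_derive_eq D); rewrite pN qN -/(K s).
  have -> : p s * H s + q s * F s - (- p s * H (- s) + q s * F (- s)) =
    p s * K s + q s * (F s - F (- s)) by rewrite /K; ring.
  rewrite FK -(tq s); move: (expR _) => e; ring.
exists (Y 0 / 2) => t.
have -> : Y 0 = Y t by exact: is_derive_0_is_cst.
rewrite /Y mulNr expRN.
have TT : T (axis t) = 2^-1 * (T (axis t) + T (axis (- t))).
  by rewrite (radial_axisN T t rT); field.
rewrite TT !B2 pN.
have -> : H t + p t * F t + (H (- t) + - p t * F (- t)) = K t + p t * (F t - F (- t)).
  by rewrite /K; ring.
rewrite FK; have := expR_gt0 (2 * phi (axis t)); move: (expR _) => e e0.
by field; rewrite gt_eqF.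
Qed.

End Axis.

(** * Gradient potentials and the elliptic equation *)

Section Potential.
Context {R : realType}.

Lemma primitive_nonneg (V : R -> R) : continuous V ->
  exists A : R -> R, forall s : R, 0 <= s -> is_derive s 1 A (V s).
Proof.
move=> cV; exists (fun x => \int[lebesgue_measure]_(t in `[-1, x]) V t)%R => s s0.
have [||||dA VA] := @continuous_FTC1_closed R V (-1) s (s + 1).
- by rewrite ltrDl.
- apply: continuous_compact_integrable; first exact: segment_compact.
  exact: continuous_subspaceT.
- by lra.
- exact: cV.
by rewrite derive1E in VA; exact: (DeriveDef dA VA).
Qed.

Context {n : nat}.
Implicit Types (x : 'rV[R]_n).

Lemma smooth_of_partial (f : 'rV[R]_n -> R) :
  (forall x, differentiable f x) -> (forall i, smooth (partial i f)) -> smooth f.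
Proof.
move=> df sf [|k]; last by split=> // i; exact: sf.
by move=> x; exact/differentiable_continuous.
Qed.

Lemma smooth_sqn : smooth (@sqn R n).
Proof.
by apply: smooth_sum => i; apply: smoothM; exact: smooth_coord.
Qed.

Lemma partial_sqn i x : partial i sqn x = 2 * x 0 i.
Proof.
have dc (j : 'I_n) := differentiable_coord x 0 j.
rewrite [LHS]/partial (_ : sqn = \sum_j (fun y : 'rV[R]_n => y 0 j * y 0 j)); last first.
  by apply/funext => y; rewrite fct_sumE.
rewrite derive_sum => [|j]; last exact/diff_derivable/differentiableM.
rewrite -(sum_deltal (fun j => 2 * x 0 j) i); apply: eq_bigr => j _.
apply: (etrans (partial_coordM i j (dc j))).
by rewrite partial_coord; ring.
Qed.

(** A primitive in the variable [s = |x| ^ 2] is used instead of one in [r = |x|]: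
    it is differentiable on all of [[0, +oo[], and [x |-> |x| ^ 2] is smooth, so that
    the origin requires no separate treatment. Smoothness beyond the first order
    is read off the gradient. *)
Lemma radial_potential (i0 : 'I_n) (phi : 'rV[R]_n -> R) (c : R) :
  smooth phi -> radial phi ->
  exists2 f, smooth f &
    forall i x, partial i f x = x 0 i * (c * expR (2 * phi x)).
Proof.
move=> sphi rphi.
pose V (s : R) := c / 2 * expR (2 * phi (axis i0 (Num.sqrt s))).
have cV : continuous V.
  move=> s.
  have c1 : {for s, continuous (fun r => phi (axis i0 (Num.sqrt r)))}.
    apply: (@continuous_comp _ _ _ (fun r => axis i0 (Num.sqrt r)) phi).
      apply: (@continuous_comp _ _ _ (@Num.sqrt R) (axis i0)).
        exact: sqrt_continuous.
      exact: scalel_continuous.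
    exact: smooth_continuous.
  have c2 := continuousM (@cst_continuous _ _ (2 : R) s) c1.
  have c3 := continuous_comp c2 (@continuous_expR R _).
  exact: (continuousM (@cst_continuous _ _ (c / 2) s) c3).
have [A dA] := primitive_nonneg V cV.
pose f x := A (sqn x).
have dsqn x : differentiable sqn x := smooth_differentiable x smooth_sqn.
have df x : differentiable f x.
  exact: (differentiable_scalar_comp _ _ _ _ (dsqn x) (dA _ (sqn_ge0 x))).
have pf i x : partial i f x = x 0 i * (c * expR (2 * phi x)).
  rewrite (partial_comp i _ _ _ _ (dsqn x) (dA _ (sqn_ge0 x))) partial_sqn.
  rewrite /V (rphi _ x); last by rewrite sqn_axis sqr_sqrtr ?sqn_ge0.
  by move: (expR _) => e; field.
exists f => //; apply: smooth_of_partial => // i.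
rewrite (_ : partial i f = fun x => x 0 i * (c * expR (2 * phi x))).
  apply: smoothM; first exact: smooth_coord.
  by apply: smoothZ; exact: smooth_exp2.
by apply/funext => x; exact: pf.
Qed.

End Potential.

Section Elliptic.
Context {R : realType} {n : nat} {phi : 'rV[R]_n -> R}.
Hypothesis sphi : smooth phi.
Implicit Types (x : 'rV[R]_n).

Lemma partial_expRZ (a : R) i x :
  partial i (fun y => expR (a * phi y)) x = a * partial i phi x * expR (a * phi x).
Proof.
have s := smooth_differentiable x sphi.
rewrite (partial_expR i _ x (smooth_differentiable x (smoothZ a phi sphi))).
by rewrite (partialZ i a phi x s) mulrC.
Qed.

Lemma laplacian_expRZ (a : R) x : laplacian (fun y => expR (a * phi y)) x =
  expR (a * phi x) * (a * laplacian phi x + a ^+ 2 * grad_dot phi phi x).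
Proof.
rewrite /laplacian /grad_dot !mulr_sumr -big_split /= mulr_sumr.
apply: eq_bigr => i _.
have -> : partial i (fun y => expR (a * phi y)) =
    fun y => (a * partial i phi y) * expR (a * phi y).
  by apply/funext => y; exact: partial_expRZ.
have sp := smooth_partial i sphi.
have d1 := smooth_differentiable x (smoothZ a _ sp).
have d2 := smooth_differentiable x (smooth_expR _ (smoothZ a phi sphi)).
apply: (etrans (partialM i _ _ x d1 d2)).
have e1 := partialZ i a _ x (smooth_differentiable x sp).
apply: (etrans (congr2 (fun p q => p * _ + _ * q) e1 (partial_expRZ a i x))).
by name_atoms R; ring.
Qed.

(** With [w = e ^ (2 phi) = u ^ (4 / (n + 2))], the Laplacian term of the equation is
    [- (n + 2) / 4 * R * u], because [u ^ m] is the power of [u] that occurs in the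
    conformal Laplacian; the rest is [beta x . grad u + gamma u]. The whole
    left-hand side is then [(n + 2) / 4 * u] times the defect in the identity
    [R - rho = 2 beta (1 + x . grad phi)]. *)
Lemma elliptic_equation_exp (m beta rho : R) : (3 <= n)%N ->
  m = (n%:R - 2) / (n%:R + 2) ->
  elliptic_equation m beta ((2 * beta + rho) / (1 - m))
    (fun x => expR ((n%:R + 2) / 2 * phi x)) <->
  forall x, scalar_curvature (exp_metric phi) x - rho =
    2 * beta * (1 + euler phi x).
Proof.
move=> n3 mE.
have n3R : 3 <= n%:R :> R by rewrite ler_nat.
pose b : R := (n%:R + 2) / 2; pose a : R := (n%:R - 2) / 2.
have um y : expR (b * phi y) `^ m = expR (a * phi y).
  rewrite -expRM; congr expR; rewrite /a /b mE.
  by move: (phi y) => s; field; apply/eqP; lra.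
have key x : (n%:R - 1) / m * laplacian (fun y => expR (b * phi y) `^ m) x
    + beta * (\sum_(i < n) x 0 i * partial i (fun y => expR (b * phi y)) x)
    + (2 * beta + rho) / (1 - m) * expR (b * phi x) =
    (n%:R + 2) / 4 * expR (b * phi x) *
    (2 * beta * (1 + euler phi x) - (scalar_curvature (exp_metric phi) x - rho)).
  have -> : (fun y => expR (b * phi y) `^ m) = fun y => expR (a * phi y).
    by apply/funext.
  have -> : \sum_(i < n) x 0 i * partial i (fun y => expR (b * phi y)) x =
      b * expR (b * phi x) * euler phi x.
    rewrite /euler mulr_sumr; apply: eq_bigr => i _.
    by rewrite partial_expRZ; name_atoms R; ring.
  rewrite laplacian_expRZ.
  have ebE : expR (b * phi x) = expR (a * phi x) * expR (2 * phi x).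
    by rewrite -expRD; congr expR; rewrite /a /b; field.
  have sc := scalar_curvature_exp_metric sphi x.
  rewrite ebE.
  have factor (e s : R) : s = expR (2 * phi x) * scalar_curvature (exp_metric phi) x ->
     (n%:R + 2) / 4 * (e * expR (2 * phi x)) * (2 * beta * (1 + euler phi x) -
       (scalar_curvature (exp_metric phi) x - rho)) =
     (n%:R + 2) / 4 * e * (expR (2 * phi x) * (2 * beta * (1 + euler phi x) + rho) - s).
    by move=> ->; move: (expR _) (euler _ _) (scalar_curvature _ _) => *; ring.
  rewrite (factor _ _ (esym sc)) {factor sc}.
  rewrite /a /b mE.
  move: (expR (_ / 2 * _)) (expR (2 * _)) (euler _ _) (laplacian _ _) (grad_dot _ _ _).
  move=> ea e2 k L N; field.
  do ?[apply/andP; split]; apply/eqP; lra.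
split=> [ell x|sol x].
  have := ell x; rewrite key => /eqP; rewrite !mulf_eq0 expR_eq0 orbF => /orP[|].
    by rewrite invr_eq0 => /orP[] /eqP; lra.
  by rewrite subr_eq0 => /eqP.
by rewrite key sol subrr mulr0.
Qed.

End Elliptic.

(** * Radial solitons *)

Section RadialSolitons.
Context {R : realType} {n : nat} {phi : 'rV[R]_n -> R}.
Hypotheses (sphi : smooth phi) (rphi : radial phi).
Implicit Types (x : 'rV[R]_n) (rho c : R).
Local Notation g := (exp_metric phi).
Local Notation d i := (partial i phi).
Local Notation dd i j := (partial i (partial j phi)).

(** The potential has gradient [c e ^ (2 phi) x]; the part of its Hessian that is
    not a multiple of the metric is antisymmetric in [x] and [grad phi], and
    vanishes because [grad phi] is parallel to [x]. *)
Lemma radial_soliton rho c (i0 : 'I_n) :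
  (forall x, scalar_curvature g x - rho = c * (1 + euler phi x)) ->
  yamabe_gradient_soliton g rho.
Proof.
move=> sol; split; first exact: riemannian_exp_metric.
have [f sf pf] := radial_potential i0 phi c sphi rphi.
exists f => // x i j.
rewrite sol hessian_exp_metric// exp_metricE !pf.
have gd : grad_dot phi f x = c * expR (2 * phi x) * euler phi x.
  rewrite /grad_dot /euler mulr_sumr; apply: eq_bigr => k _.
  by rewrite pf; name_atoms R; ring.
have -> : partial i (partial j f) x =
    (i == j)%:R * (c * expR (2 * phi x))
    + x 0 j * (c * (2 * d i x * expR (2 * phi x))).
  have -> : partial j f = fun y => y 0 j * (c * expR (2 * phi y)).
    by apply/funext => y; exact: pf.
  have s2 := smooth_exp2 sphi.
  apply: (etrans (partial_coordM i j (smooth_differentiable x (smoothZ c _ s2)))).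
  congr (_ + _ * _).
  apply: (etrans (partialZ i c _ x (smooth_differentiable x s2))).
  by congr (_ * _); exact: partial_expRZ.
rewrite gd; have := radial_rotation sphi rphi i j x.
move: (euler _ _) (expR _) => k e.
move: (d i x) (d j x) (x 0 i) (x 0 j) => di dj xi xj rot.
name_atoms R.
transitivity (a * (c * e) * (1 + k) + c * e * (xj * di - xi * dj)); last by ring.
by rewrite rot; ring.
Qed.

Lemma radial_scalar_curvature : radial (fun x =>
  expR (2 * phi x) * scalar_curvature g x).
Proof.
move=> x y xy; rewrite !scalar_curvature_exp_metric//.
by rewrite (radial_laplacian sphi rphi _ _ xy) (radial_grad_dot sphi rphi _ _ xy).
Qed.

(** The identity on one axis propagates to the whole space since both sides are
    radial. *)
Lemma soliton_profile rho (i0 i1 : 'I_n) : i1 != i0 ->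
  yamabe_gradient_soliton g rho ->
  exists c, forall x, scalar_curvature g x - rho = c * (1 + euler phi x).
Proof.
move=> i10 [_ [f sf hess]].
pose T x := expR (2 * phi x) * scalar_curvature g x - rho * expR (2 * phi x).
have TE x : T x = (scalar_curvature g x - rho) * expR (2 * phi x).
  by rewrite /T mulrBl [X in X - _]mulrC.
have rT : radial T.
  by move=> x y xy; rewrite /T (radial_scalar_curvature _ _ xy) (rphi _ _ xy).
have [|c Tc] := axis_soliton i0 phi sphi rphi i1 f T i10 sf rT.
  move=> x i j; have := hess x i j.
  by rewrite hessian_exp_metric// exp_metricE TE => <-; rewrite mulrCA mulrA.
exists c => x.
have xy : sqn x = sqn (axis i0 (Num.sqrt (sqn x))).
  by rewrite sqn_axis sqr_sqrtr ?sqn_ge0.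
have e0 := expR_gt0 (2 * phi x).
apply: (mulIf (lt0r_neq0 e0)); rewrite -TE (rT _ _ xy) Tc -axis_euler.
rewrite -(radial_euler sphi rphi _ _ xy) -(rphi _ _ xy).
by rewrite -mulrA [expR _ * _]mulrC mulrA.
Qed.

Lemma sectional_exp_metric_gt0 (i j : 'I_n) x :
  positive_sectional_curvature g -> i != j ->
  0 < - dd i i x - dd j j x + d i x ^+ 2 + d j x ^+ 2 - grad_dot phi phi x.
Proof.
move=> pos ij; have := pos x _ _ (row_free_delta_mx i j ij).
by rewrite sectional_curvature_exp_metric// pmulr_rgt0// invr_gt0 expR_gt0.
Qed.

(** At the origin [rho + c] is the scalar curvature; since [grad phi] vanishes there
    and the Hessian of [phi] is a multiple of the identity, it is a positive
    multiple of the sectional curvature of any single plane. *)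
Lemma soliton_constant_origin rho c (i0 i1 : 'I_n) : (3 <= n)%N -> i1 != i0 ->
  positive_sectional_curvature g ->
  (forall x, scalar_curvature g x - rho = c * (1 + euler phi x)) ->
  0 < rho + c.
Proof.
move=> n3 i10 pos sol.
have n3R : 3 <= n%:R :> R by rewrite ler_nat.
have := sectional_exp_metric_gt0 i1 i0 (axis i0 0) pos i10.
have := scalar_curvature_exp_metric sphi (axis i0 0).
have := sol (axis i0 0).
rewrite axis_euler// mul0r addr0 mulr1.
rewrite axis_grad_dot// axis_partial0// (axis_partial i0 phi sphi rphi i1 0 i10).
rewrite (axis_partial2_origin i0 phi sphi rphi i1).
have -> : laplacian phi (axis i0 0) = n%:R * dd i0 i0 (axis i0 0).
  rewrite /laplacian (eq_bigr (fun _ => dd i0 i0 (axis i0 0))) => [|j _].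
    by rewrite sumr_const card_ord mulr_natl.
  exact: axis_partial2_origin.
have := expR_gt0 (2 * phi (axis i0 0)).
move: (expR _) (scalar_curvature _ _) (dd i0 i0 _) => e s a e0 sc.
rewrite !mulr0 expr0n /= !addr0 !subr0 => es a0.
have -> : rho + c = s by lra.
rewrite -(pmulr_rgt0 _ e0) es.
rewrite (_ : _ * (_ * a) = (n%:R - 1) * n%:R * (- a - a)); last by ring.
by rewrite mulr_gt0// mulr_gt0//; lra.
Qed.

(** The planes spanned by the axis and an orthogonal direction give the sign of the
    derivative of [1 + t p], those orthogonal to the axis give [(1 + t p) ^ 2 <= 1]. *)
Lemma soliton_constant_ge0 rho c (i0 i1 i2 : 'I_n) : (3 <= n)%N ->
  i1 != i0 -> i2 != i0 -> i1 != i2 ->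
  positive_sectional_curvature g -> 0 < rho ->
  (forall x, scalar_curvature g x - rho = c * (1 + euler phi x)) ->
  0 <= c.
Proof.
move=> n3 i10 i20 i12 pos rho0 sol; rewrite leNgt; apply/negP => c0.
have rc0 := soliton_constant_origin rho c i0 i1 n3 i10 pos sol.
have nE : (n = (n - 3).+3)%N by rewrite -[in LHS](subnK n3) addn3.
apply: (@profile_contradiction R (n - 3) c rho (fun t => phi (axis i0 t))
  (fun t => d i0 (axis i0 t)) (fun t => dd i0 i0 (axis i0 t)) c0 rho0 rc0).
- by move=> t; exact: is_derive_axis.
- by move=> t; apply: is_derive_axis; exact: smooth_partial.
- move=> t; rewrite -nE exprMn.
  have -> : expR (phi (axis i0 t)) ^+ 2 = expR (2 * phi (axis i0 t)).
    by rewrite expRM_natl.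
  have := scalar_curvature_exp_metric sphi (axis i0 t).
  have := axis_laplacian i0 phi sphi rphi t.
  have := sol (axis i0 t); rewrite axis_euler// axis_grad_dot//.
  move: (expR _) (scalar_curvature _ _) (laplacian _ _) (dd i0 i0 _) (d i0 _).
  move=> e s L p1 p sE LE es.
  rewrite (_ : rho + _ = s); last by rewrite -sE; ring.
  transitivity (t ^+ 2 * (e * s)); first by ring.
  rewrite es.
  transitivity (- 2 * (n%:R - 1) * t * (t * L) - (n%:R - 1) * (n%:R - 2) * (p * p) * t ^+ 2).
    by ring.
  by rewrite LE; ring.
- move=> t t0.
  have := sectional_exp_metric_gt0 i1 i0 (axis i0 t) pos i10.
  rewrite axis_grad_dot// (axis_partial i0 phi sphi rphi i1 t i10).
  have := axis_partial2 i0 phi sphi rphi t i10.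
  move: (dd i1 i1 _) (dd i0 i0 _) (d i0 _) => b a p bp.
  rewrite expr0n /= addr0 expr2 addrK => ab.
  by rewrite -bp; nra.
- move=> t t0.
  have := sectional_exp_metric_gt0 i1 i2 (axis i0 t) pos i12.
  rewrite axis_grad_dot// (axis_partial i0 phi sphi rphi i1 t i10).
  rewrite (axis_partial i0 phi sphi rphi i2 t i20).
  have := axis_partial2 i0 phi sphi rphi t i10.
  have := axis_partial2 i0 phi sphi rphi t i20.
  move: (dd i1 i1 _) (dd i2 i2 _) (d i0 _) => b a p ap bp.
  rewrite expr0n /= !addr0 => ab.
  have : 0 <= t * t * (- b - a - p * p).
    by apply: mulr_ge0; [exact: mulr_ge0 | lra].
  have -> : t * t * (- b - a - p * p) = - t * (t * b) - t * (t * a) - (t * p) ^+ 2.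
    by ring.
  by rewrite ap bp !mulNr; move: (t * p) => s; nra.
Qed.

End RadialSolitons.

Theorem proposition1p4 (R : realType) (n : nat) (hn : (3 <= n)%N) (rho : R) :
  let m : R := (n%:R - 2) / (n%:R + 2) in
  (forall u : 'rV[R]_n -> R,
     (forall x, 0 < u x) ->
     rotationally_symmetric u ->
     yamabe_gradient_soliton (conformal_metric u) rho ->
     positive_sectional_curvature (conformal_metric u) ->
     exists beta : R,
       [/\ 0 <= beta,
           rho < 0 -> 0 < beta,
           smooth u
         & elliptic_equation m beta ((2 * beta + rho) / (1 - m)) u])
  /\
  (forall (u : 'rV[R]_n -> R) (beta : R),
     0 <= beta ->
     (rho < 0 -> 0 < beta) ->
     smooth u ->
     (forall x, 0 < u x) ->
     rotationally_symmetric u ->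
     elliptic_equation m beta ((2 * beta + rho) / (1 - m)) u ->
     yamabe_gradient_soliton (conformal_metric u) rho).
Proof.
move=> m.
have n3R : 3 <= n%:R :> R by rewrite ler_nat.
pose i0 : 'I_n := Ordinal (leq_trans (isT : (0 < 3)%N) hn).
pose i1 : 'I_n := Ordinal (leq_trans (isT : (1 < 3)%N) hn).
pose i2 : 'I_n := Ordinal hn.
pose phi (u : 'rV[R]_n -> R) x := 2 / (n%:R + 2) * ln (u x).
have metricE u : (forall x, 0 < u x) -> conformal_metric u = exp_metric (phi u).
  move=> u0; apply/funext => x; rewrite /conformal_metric /exp_metric /powR.
  rewrite gt_eqF//; congr (expR _)%:M; rewrite /phi.
  by move: (ln _) => l; field; apply/eqP; lra.
have uE u : (forall x, 0 < u x) -> u = fun x => expR ((n%:R + 2) / 2 * phi u x).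
  move=> u0; apply/funext => x; rewrite /phi.
  rewrite -[LHS](@lnK R) ?posrE//; congr expR.
  by move: (ln _) => l; field; apply/eqP; lra.
have rphi u : rotationally_symmetric u -> radial (phi u).
  by move=> /rotationally_symmetric_radial ru x y xy; rewrite /phi (ru _ _ xy).
split=> [u u0 /rphi rp|u beta _ _ su u0 /rphi rp].
- rewrite (metricE u u0) => sol pos.
  have sp : smooth (phi u).
    have [[sg _ _] _] := sol.
    have -> : phi u = fun x => 2^-1 * ln (exp_metric (phi u) x i0 i0).
      apply/funext => x; rewrite exp_metricE eqxx mul1r expRK.
      by rewrite mulKf.
    apply: smoothZ; apply: smooth_ln; last exact: sg.
    by move=> x; rewrite exp_metricE eqxx mul1r expR_gt0.
  have [c cE] := soliton_profile sp rp rho i0 i1 isT sol.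
  have rc0 := soliton_constant_origin sp rp rho c i0 i1 hn isT pos cE.
  exists (c / 2); split.
  + rewrite divr_ge0//; have [rho0|rho0] := ltP 0 rho; last by lra.
    exact: (soliton_constant_ge0 sp rp rho c i0 i1 i2).
  + by move=> rho0; lra.
  + by rewrite (uE u u0); apply: smooth_expR; exact: smoothZ.
  + rewrite (uE u u0); apply/elliptic_equation_exp => // x.
    by rewrite cE mulrC; field.
- have sp : smooth (phi u) by apply: smoothZ; exact: smooth_ln.
  rewrite (metricE u u0) {1}(uE u u0) => ell.
  apply: (radial_soliton sp rp rho (2 * beta) i0).
  by apply/(elliptic_equation_exp sp).
Qed.
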